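(* Let $\mathbf{u}_c\in\mathbf{E}(\Omega)$, and let $\lambda\in H^2(\Omega)$ satisfy $$\Delta\lambda=\nabla\cdot\big(\mathcal{M}^*S(\mathcal{M}\mathbf{u}_c-\mathbf{U}^0)\big)\quad\text{in }\Omega,$$ together with one of the two boundary conditions $$\big(\mathcal{M}^*S(\mathcal{M}\mathbf{u}_c-\mathbf{U}^0)-\nabla\lambda\big)\cdot\nu=0\ \text{ on }\Gamma,\qquad\text{or}\qquad \lambda=0\ \text{ on }\Gamma.$$ Put $\mathbf{p}=-\big(\mathcal{M}^*S(\mathcal{M}\mathbf{u}_c-\mathbf{U}^0)-\nabla\lambda\big)$ and $f(t)=J(\mathbf{u}_c+t\mathbf{p})$ for $t\in\mathbb{R}$. Then $$f(t)=J(\mathbf{u}_c)-t\langle\mathbf{p},\mathbf{p}\rangle_{\mathbf{L}^2(\Omega)}+\frac{t^2}{2}\langle S\mathcal{M}\mathbf{p},\mathcal{M}\mathbf{p}\rangle_{\mathbf{L}^2(\Omega)}\qquad(t\in\mathbb{R}).$$ If moreover the first two components of $\mathbf{p}$ form a nontrivial vector field, i.e. $\mathcal{M}\mathbf{p}\neq0$ in $(L^2(\Omega))^2$, then $f$ has a unique minimizer $$t_c=\frac{\langle\mathbf{p},\mathbf{p}\rangle_{\mathbf{L}^2(\Omega)}}{\langle S\mathcal{M}\mathbf{p},\mathcal{M}\mathbf{p}\rangle_{\mathbf{L}^2(\Omega)}},$$ so that the adjusted field for $\mathbf{u}_c$ in the direction $\mathbf{p}$ is $\mathbf{u}_+=\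mathbf{u}_c-t_c\big(\mathcal{M}^*S(\mathcal{M}\mathbf{u}_c-\mathbf{U}^0)-\nabla\lambda\big)$.
   Context: $\Omega\subset\mathbb{R}^3$ is a bounded Lipschitz domain with boundary $\Gamma$ and outward unit normal $\nu$; functions are real valued and $\mathbf{L}^2(\Omega)$ denotes $(L^2(\Omega))^n$ ($n=3$ or $n=2$ according to the fields involved) with its standard inner product. $\mathbf{E}(\Omega)=\{\mathbf{u}\in(L^2(\Omega))^3:\nabla\cdot\mathbf{u}\in L^2(\Omega)\}$, with distributional divergence. For $\mathbf{h}\in\mathbf{E}(\Omega)$ the normal trace $\mathbf{h}\cdot\nu\in H^{-1/2}(\Gamma)$ is understood in the generalized sense, so that $\int_\Omega\lambda\,\nabla\cdot\mathbf{h}\,dx=\int_{\Gamma}\lambda\,\mathbf{h}\cdot\nu\,d\Gamma-\int_\Omega\nabla\lambda\cdot\mathbf{h}\,dx$ for all $\lambda\in H^1(\Omega)$, the boundary integral being the duality pairing of $H^{-1/2}(\Gamma)$ and $H^{1/2}(\Gamma)$. The observation operator $\mathcal{M}:(L^2(\Omega))^3\to(L^2(\Omega))^2$ is $\mathcal{M}(u_1,u_2,u_3)=(u_1,u_2)$, with adjoint $\mathcal{M}^*(U_1,U_2)=(U_1,U_2,0)$. $\mathbf{U}^0\in(L^2(\Omega))^2$ is given, $S$ is a constant real symmetric positive definite $2\times2$ matrix, and $$J(\mathbf{u})=\frac12\int_\Omega S(\mathcal{M}\mathbf{u}-\mathbf{U}^0)\cdot(\mathcal{M}\mathbf{u}-\mathbf{U}^0)\,dx.$$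 The adjusted field for $\mathbf{u}_c$ in the direction $\mathbf{p}$ is $\mathbf{u}_+=\mathbf{u}_c+t_c\mathbf{p}$, where $t_c$ is the unique minimizer over $t\in\mathbb{R}$ of $t\mapsto J(\mathbf{u}_c+t\mathbf{p})$. *)

(* Defs.v *)
From HB Require Import structures.
From mathcomp Require Import all_boot all_order all_algebra.
From mathcomp Require Import all_classical all_reals all_analysis.
Import Order.TTheory GRing.Theory Num.Theory.
Import numFieldNormedType.Exports.

Set Implicit Arguments.
Unset Strict Implicit.
Unset Printing Implicit Defensive.

Local Open Scope classical_set_scope.
Local Open Scope ring_scope.

(* A point x of R^3 is a triple, so that the product topology and iterated
   product measures apply; values of vector fields are column vectors. *)
Notation point3 R := (R * R * R)%type.
(* The same carrier, with the Borel sigma-algebra on which lebesgue_measure is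
   declared. *)
Notation borel3 R :=
  (measurableTypeR R * measurableTypeR R * measurableTypeR R)%type.
Notation field R n := (point3 R -> 'cV[R]_n).

Section Euclidean.
Variable R : realType.

Definition lebesgue3 : {measure set (borel3 R) -> \bar R} :=
  ((@lebesgue_measure R \x @lebesgue_measure R) \x @lebesgue_measure R)%E.

Definition component (i : 'I_3) (x : point3 R) : R :=
  nth 0 [:: x.1.1; x.1.2; x.2] i.

Definition to_cV (x : point3 R) : 'cV[R]_3 := \col_i component i x.

Definition basis3 (i : 'I_3) : point3 R :=
  ((i == 0 :> nat)%N%:R, (i == 1 :> nat)%N%:R, (i == 2 :> nat)%N%:R).

Definition dot n (v w : 'cV[R]_n) : R := \sum_(i < n) v i 0 * w i 0.

Definition sym_posdef n (S : 'M[R]_n) : Prop :=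
  S^T = S /\ forall v : 'cV[R]_n, v != 0 -> 0 < dot (S *m v) v.

Definition partial (i : 'I_3) (f : point3 R -> R) : point3 R -> R :=
  'D_(basis3 i) f.

Definition grad (f : point3 R -> R) : field R 3 :=
  fun x => \col_i partial i f x.

Fixpoint Ck (k : nat) (f : point3 R -> R) : Prop :=
  continuous f /\
  if k is k'.+1 then
    forall i, (forall x, derivable f x (basis3 i)) /\ Ck k' (partial i f)
  else True.

Definition smooth (f : point3 R -> R) : Prop := forall k, Ck k f.

Definition boundary (Omega : set (point3 R)) : set (point3 R) :=
  closure Omega `\` interior Omega.

(* Near x0, in the orthonormal coordinates y = Q (x - x0), Omega is the part of
   the box |y_0|, |y_1| < r, |y_2| < h lying strictly below the graph of a
   Lipschitz function (whence the boundary is exactly the graph there). *)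
Definition lipschitz_graph_near (Omega : set (point3 R)) (x0 : point3 R) : Prop :=
  exists (Q : 'M[R]_3) (gamma : R * R -> R) (r h : R),
    [/\ Q *m Q^T = 1%:M, 0 < r, 0 < h, lipschitz gamma &
        (forall y, `|y.1| < r -> `|y.2| < r -> `|gamma y| < h) /\
        forall x, let y := Q *m (to_cV x - to_cV x0) in
          let y0 := y (inord 0%N) 0 in
          let y1 := y (inord 1%N) 0 in
          let y2 := y (inord 2%N) 0 in
          `|y0| < r -> `|y1| < r -> `|y2| < h ->
          (Omega x <-> y2 < gamma (y0, y1))].

Definition bounded_lipschitz_domain (Omega : set (point3 R)) : Prop :=
  [/\ open Omega, connected Omega, Omega !=set0, bounded_set Omega &
      forall x0, boundary Omega x0 -> lipschitz_graph_near Omega x0].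

End Euclidean.

Section Sobolev.
Variable R : realType.
Variable Omega : set (point3 R).

(* Elements of L^2 are represented by functions on the whole space, of which
   only the values in Omega matter. *)
Definition L2 (f : point3 R -> R) : Prop :=
  measurable_fun (Omega : set (borel3 R)) (f : borel3 R -> R) /\
  (@lebesgue3 R).-integrable Omega (fun x => (f x ^+ 2)%:E).

Definition L2vec n (u : field R n) : Prop := forall i, L2 (fun x => u x i 0).

Definition integral_on (f : point3 R -> R) : R :=
  (\int[@lebesgue3 R]_(x in Omega) f x)%R.

Definition inner n (u v : field R n) : R := integral_on (fun x => dot (u x) (v x)).

Definition zero_ae n (u : field R n) : Prop :=
  {ae @lebesgue3 R, forall x, Omega x -> u x = 0}.

Definition test_function (phi : point3 R -> R) : Prop :=
  [/\ smooth phi, compact (closure [set x | phi x != 0]) &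
      closure [set x | phi x != 0] `<=` Omega].

(* Distributions on Omega are given by their action on test functions. *)
Definition distr_div (u : field R 3) (phi : point3 R -> R) : R :=
  - inner u (grad phi).

Definition distr_laplacian (f phi : point3 R -> R) : R :=
  integral_on (fun x => f x * \sum_(i < 3) partial i (partial i phi) x).

(* d is the distributional divergence of u, and it is in L^2. *)
Definition has_div (u : field R 3) (d : point3 R -> R) : Prop :=
  L2 d /\ forall phi, test_function phi ->
    distr_div u phi = integral_on (fun x => d x * phi x).

Definition Ediv (u : field R 3) : Prop := L2vec u /\ exists d, has_div u d.

(* f is in H^1 and Df represents its weak gradient. *)
Definition has_grad (f : point3 R -> R) (Df : field R 3) : Prop :=
  [/\ L2 f, L2vec Df & forall phi, test_function phi -> forall i,
      integral_on (fun x => f x * partial i phi x) =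
      - integral_on (fun x => Df x i 0 * phi x)].

Definition H1 (f : point3 R -> R) : Prop := exists Df, has_grad f Df.

Definition H2 (f : point3 R -> R) : Prop :=
  exists2 Df, has_grad f Df & forall i, H1 (fun x => Df x i 0).

(* The duality pairing of h.nu with the boundary values of f, where d is the
   divergence of h and Df the gradient of f; the generalized normal trace is
   given by Green's formula. *)
Definition normal_trace (h : field R 3) (d f : point3 R -> R)
    (Df : field R 3) : R :=
  integral_on (fun x => f x * d x) + inner Df h.

Definition zero_normal_trace (h : field R 3) : Prop :=
  L2vec h /\ exists2 d, has_div h d &
    forall f Df, has_grad f Df -> normal_trace h d f Df = 0.

Definition H1norm (f : point3 R -> R) (Df : field R 3) : R :=
  Num.sqrt (integral_on (fun x => f x ^+ 2) + inner Df Df).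

(* The norm of H^{1/2} on the boundary, as the range of the trace operator: the
   least H^1 norm of an extension to Omega, here for a function g that is the
   restriction of a smooth function (for another g the set may be empty, and
   inf would give 0). *)
Definition Hhalf_norm (g : point3 R -> R) : R :=
  inf [set H1norm v (grad v) |
       v in [set v | smooth v /\ forall x, boundary Omega x -> v x = g x]].

(* The trace operator is the extension by continuity, from H^1 to H^{1/2} of the
   boundary, of the restriction map v |-> v|_boundary, defined on functions
   smooth up to the boundary.  So f vanishes on the boundary when it is the H^1
   limit of smooth functions whose boundary values tend to 0 in H^{1/2}; phi n
   is not required to vanish on or near the boundary. *)
Definition zero_trace (f : point3 R -> R) : Prop :=
  exists2 Df, has_grad f Df &
  exists phi : nat -> point3 R -> R,
    [/\ forall n, smooth (phi n),
        (fun n => H1norm (phi n \- f) (grad (phi n) \- Df)) @ \oo --> (0 : R) &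
        (fun n => Hhalf_norm (phi n)) @ \oo --> (0 : R)].

End Sobolev.

Section Adjustment.
Variable R : realType.

(* 'cV_3 is read as 'cV_(2 + 1): obs keeps the first two components and obs_adj
   appends a zero third component. *)
Definition obs (u : field R 3) : field R 2 :=
  fun x => @usubmx R 2 1 1 (u x).

Definition obs_adj (U : field R 2) : field R 3 :=
  fun x => @col_mx R 2 1 1 (U x) 0.

Definition J Omega (S : 'M[R]_2) (U0 : field R 2) (u : field R 3) : R :=
  2^-1 * inner Omega (fun x => S *m (obs u x - U0 x)) (obs u \- U0).

Definition unique_minimizer (f : R -> R) (t : R) : Prop :=
  (forall s, f t <= f s) /\ forall t', (forall s, f t' <= f s) -> t' = t.

Definition adjusted_field (cost : field R 3 -> R) (uc p up : field R 3) : Prop :=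
  exists2 t, unique_minimizer (fun s => cost (fun x => uc x + s *: p x)) t &
             up = (fun x => uc x + t *: p x).

End Adjustment.

(* Main.v *)
Require Import Defs.
From HB Require Import structures.
From mathcomp Require Import all_boot all_order all_algebra.
From mathcomp Require Import all_classical all_reals all_analysis.
From mathcomp Require Import measurable_realfun.
From mathcomp Require Import ring lra.
Import Order.TTheory GRing.Theory Num.Theory.
Import numFieldNormedType.Exports.
Set Implicit Arguments.
Unset Strict Implicit.
Unset Printing Implicit Defensive.
Local Open Scope classical_set_scope.
Local Open Scope ring_scope.

(** Let g = M^* S (M uc - U0) and h = g - grad lambda, so that p = - h.  Expanding the quadratic
    cost along the line gives J (uc + t p) = J (uc) + t <g, p> + t^2 / 2 <S M p, M p>
    ([J_line]).  Since g = grad lambda - p, the slope at t = 0 is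
    <g, p> = - <p, p> + <grad lambda, p>, and the whole theorem reduces to the
    orthogonality <grad lambda, h> = 0.  Given that, f is a parabola, whose leading
    coefficient is positive when M p is nontrivial because S is positive definite
    ([inner_posdef_gt0], [quadratic_unique_minimizer]).

    The equation for lambda says that h has distributional divergence zero, that is,
    h is orthogonal to the gradients of test functions ([weakly_divergence_free]).  The
    boundary condition upgrades this to orthogonality to grad lambda.

    If the normal trace of h is zero, Green's formula reads
    <grad lambda, h> = - <lambda, div h>.  The function div h is in L^2 and has zero
    integral against every test function, so it is zero almost everywhere: bumps made from
    exp(-1/x) converge to indicators of boxes, and boxes generate the Borel sets
    ([test_function_separating]).

    If lambda has zero trace, it is an H^1 limit of smooth functions w that vanish
    at every point of the boundary: correct each approximant by a smooth function with the same
    boundary values and small H^1 norm ([zero_trace_orthogonal]).  For such w, smooth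
    truncations G_n (w) that vanish where |w| < 1/(n+1) restrict to test functions of Omega
    ([test_trunc]), so <grad (G_n (w)), h> = 0.  The slopes G_n' are bounded and tend to 1
    away from 0, while grad w = 0 almost everywhere on the set w = 0
    ([partial0_on_level_set]); dominated convergence gives <grad w, h> = 0
    ([orthogonal_vanishing_boundary]), and the limit in H^1 gives <grad lambda, h> = 0. *)

(** * Smooth functions built from exp(-1/x) *)

Section Flat.
Variable R : realType.

(** The derivative of P(1/x) exp(-1/x) on x > 0 has the same form, so this family is
    closed under differentiation; that is what makes each member smooth. *)
Definition flat (P : {poly R}) (x : R) : R :=
  if 0 < x then P.[x^-1] * expR (- x^-1) else 0.

(** The polynomial of the derivative: with u = 1/x one has
    (P(u) exp(-u))' = u^2 (P(u) - P'(u)) exp(-u). *)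
Definition flat_next (P : {poly R}) : {poly R} := 'X^2 * (P - P^`()).

Lemma poly_expRN_bounded (P : {poly R}) :
  exists C : R, forall u, 0 < u -> `|P.[u]| * expR (- u) <= C.
Proof.
(* u ^ i exp(-u) <= i! for u > 0, term by term. *)
exists (\sum_(i < size P) `|P`_i| * (i`!%:R)) => u u0.
rewrite horner_coef.
have : `|\sum_(i < size P) P`_i * u ^+ i| * expR (- u) <=
       (\sum_(i < size P) `|P`_i * u ^+ i|) * expR (- u).
  by rewrite ler_wpM2r ?expR_ge0 ?ler_norm_sum.
move/le_trans; apply.
rewrite mulr_suml; apply: ler_sum => i _.
rewrite normrM -mulrA ler_wpM2l// ger0_norm ?exprn_ge0 ?(ltW u0)//.
rewrite expRN ler_pdivrMr ?expR_gt0//.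
case: (nat_of_ord i) => [|n]; first by rewrite expr0 fact0 mul1r -expR0 ler_expR ltW.
rewrite mulrC -ler_pdivrMr ?ltr0n ?fact_gt0//.
by have := expR_ge1Dxn n (ltW u0); lra.
Qed.

(** At x = 0 the difference quotient is O(x), because u^2 P(u) exp(-u) is bounded for
    u = 1/x; on either side of 0 this is the chain rule. *)
Lemma is_derive_flat (P : {poly R}) (x : R) :
  is_derive x 1 (flat P) (flat (flat_next P) x).
Proof.
have [x0|x0|->] := ltgtP x 0.
- rewrite /flat ltNge (ltW x0)/=.
  apply: (@near_eq_is_derive _ _ _ (cst 0)).
  near=> y; have yx : y < 0 by near: y; exact: lt_nbhsl.
  by rewrite ltNge (ltW yx).
- have dinv : is_derive x 1 (fun y : R => y^-1) (- x ^- 2 *: 1).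
    by apply: is_deriveV; rewrite gt_eqF.
  have dP : is_derive x 1 (horner P \o (fun y : R => y^-1))
     (P^`().[x^-1] * (- x ^- 2 *: 1)).
    exact: is_derive1_comp.
  have dN : is_derive x 1 (fun y : R => - y^-1) (- (- x ^- 2 *: 1)).
    exact: is_deriveN.
  have dE : is_derive x 1 (expR \o (fun y : R => - y^-1))
     (expR (- x^-1) * (- (- x ^- 2 *: 1))).
    exact: is_derive1_comp.
  have dPE := @is_deriveM _ _ _ _ _ _ _ _ dP dE.
  have -> : flat (flat_next P) x = P.[x^-1] *: (expR (- x^-1) * (- (- x ^- 2 *: 1)))
      + expR (- x^-1) *: (P^`().[x^-1] * (- x ^- 2 *: 1)).
    rewrite /flat x0 /flat_next /= hornerM hornerXn hornerD hornerN.
    rewrite /GRing.scale /= -!exprVn; ring.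
  apply: near_eq_is_derive dPE.
  near=> y; have yx : 0 < y by near: y; exact: lt_nbhsr.
  by rewrite /flat yx.
- rewrite [flat _ 0]/flat ltxx.
  have [C HC] := poly_expRN_bounded ('X^2 * P).
  have lim0 : h^-1 *: ((flat P \o shift 0) (h *: 1) - flat P 0) @[h --> 0^'] --> (0 : R).
    apply: (@cvg_to_0_linear _ _ C 1) => // r /andP[r0 _] /=.
    rewrite /flat ltxx subr0 addr0 /GRing.scale /= mulr1.
    case: ifPn => [rp|_]; last first.
      rewrite mulr0 normr0 mulr_ge0 ?normr_ge0//.
      by apply: le_trans (HC 1 _) => //; rewrite mulr_ge0 ?expR_ge0.
    have rV : 0 < r^-1 by rewrite invr_gt0.
    have := HC _ rV; rewrite hornerM hornerXn !normrM.
    rewrite (ger0_norm (expR_ge0 _)) (ger0_norm (ltW rp)).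
    rewrite (@ger0_norm _ (r^-1)) ?(ltW rV)// => H.
    have -> : r^-1 * (`|P.[r^-1]| * expR (- r^-1)) =
       (r^-1 / r * `|P.[r^-1]| * expR (- r^-1)) * r.
      by field; rewrite gt_eqF.
    by rewrite ler_wpM2r// ltW.
  by apply: DeriveDef; [apply/cvg_ex; exists 0|exact: cvg_lim lim0].
Unshelve. all: by end_near. Qed.

End Flat.

(** * Functions of class C^k on space *)

Section Calculus.
Variable R : realType.
Implicit Types f g w : point3 R -> R.

(** Only the derivative of w in the single direction v is assumed, so the chain rule is
    applied to the restriction of w to the line through x directed by v. *)
Lemma is_derive_comp (V : normedModType R) (w : V -> R) (F : R -> R) (x v : V) (F' : R) :
  derivable w x v -> is_derive (w x) 1 F F' ->
  is_derive x v (F \o w) (F' * 'D_v w x).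
Proof.
move=> dw dF.
have line (V' : normedModType R) (f : V -> V') :
    'D_v f x = 'D_1 (fun h : R => f (h *: v + x)) 0.
  have e : (fun h : R => h^-1 *: ((f \o shift x) (h *: v) - f x)) =
      (fun h : R => h^-1 *: (((fun h : R => f (h *: v + x)) \o shift (0 : R)) (h *: (1 : R))
                             - f ((0 : R) *: v + x))).
    apply/funext => h /=; rewrite addr0 scale0r add0r.
    by rewrite /GRing.scale /= mulr1.
  by rewrite /derive e.
have dwl : is_derive (0 : R) 1 (fun h : R => w (h *: v + x)) ('D_v w x).
  exact: (DeriveDef ((derivable1P w x v).1 dw) (esym (line _ w))).
have dFl : is_derive (w (0 *: v + x)) 1 F F' by rewrite scale0r add0r.
have [d1 d2] := @is_derive1_comp R F (fun h : R => w (h *: v + x)) 0 F' ('D_v w x) dFl dwl.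
apply: DeriveDef; first exact/derivable1P.
by rewrite line -d2.
Qed.

Lemma is_derive_affine (f : point3 R -> R) (x v : point3 R) (c : R) :
  (forall h : R, f (h *: v + x) = h * c + f x) -> is_derive x v f c.
Proof.
move=> H.
have lim0 : h^-1 *: ((f \o shift x) (h *: v) - f x) @[h --> 0^'] --> c.
  apply: cvg_near_cst; near=> h.
  have h0 : h != 0 by near: h; exact: nbhs_dnbhs_neq.
  by rewrite /= H addrK /GRing.scale/= mulKf.
by apply: DeriveDef; [apply/cvg_ex; exists c|exact: cvg_lim lim0].
Unshelve. all: by end_near. Qed.

Lemma CkS k f : Ck k.+1 f -> Ck k f.
Proof.
elim: k f => [|k IH] f; first by case.
by case=> cf df; split=> // i; have [di fi] := df i; split=> //; exact: IH.
Qed.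

Lemma Ck_cst k (c : R) : Ck k (fun=> c).
Proof.
elim: k c => [|k IH] c; split=> //; try exact: cst_continuous.
move=> i; split; first by move=> x; exact: derivable_cst.
have -> : partial i (fun=> c) = fun=> 0 by apply/funext => x; exact: derive_cst.
exact: IH.
Qed.

Lemma partialD i f g : (forall x, derivable f x (basis3 R i)) ->
  (forall x, derivable g x (basis3 R i)) ->
  partial i (fun x => f x + g x) = fun x => partial i f x + partial i g x.
Proof. by move=> df dg; apply/funext => x; exact: deriveD. Qed.

Lemma partialB i f g : (forall x, derivable f x (basis3 R i)) ->
  (forall x, derivable g x (basis3 R i)) ->
  partial i (fun x => f x - g x) = fun x => partial i f x - partial i g x.
Proof. by move=> df dg; apply/funext => x; exact: deriveB. Qed.

Lemma partialM i f g : (forall x, derivable f x (basis3 R i)) ->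
  (forall x, derivable g x (basis3 R i)) ->
  partial i (fun x => f x * g x) =
  fun x => f x * partial i g x + g x * partial i f x.
Proof. by move=> df dg; apply/funext => x; exact: deriveM. Qed.

Lemma CkD k f g : Ck k f -> Ck k g -> Ck k (fun x => f x + g x).
Proof.
elim: k f g => [|k IH] f g [cf df] [cg dg];
  (split; first by move=> x; apply: continuousD; [exact: cf|exact: cg]) => //.
move=> i; have [dfi fi] := df i; have [dgi gi] := dg i.
split; first by move=> x; exact: derivableD.
by rewrite partialD//; exact: IH.
Qed.

Lemma CkM k f g : Ck k f -> Ck k g -> Ck k (fun x => f x * g x).
Proof.
elim: k f g => [|k IH] f g Cf Cg; have [cf df] := Cf; have [cg dg] := Cg;
  (split; first by move=> x; apply: continuousM; [exact: cf|exact: cg]) => //.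
move=> i; have [dfi fi] := df i; have [dgi gi] := dg i.
split; first by move=> x; exact: derivableM.
by rewrite partialM//; apply: CkD; apply: IH => //; exact: CkS.
Qed.

Lemma CkB k f g : Ck k f -> Ck k g -> Ck k (fun x => f x - g x).
Proof.
move=> Cf Cg; have -> : (fun x => f x - g x) = (fun x => f x + (-1) * g x).
  by apply/funext => x; rewrite mulN1r.
by apply: CkD => //; apply: CkM => //; exact: Ck_cst.
Qed.

Lemma Ck_prod k n (F : 'I_n -> point3 R -> R) :
  (forall i, Ck k (F i)) -> Ck k (fun x => \prod_(i < n) F i x).
Proof.
elim: n F => [|n IH] F CF.
  rewrite (_ : (fun _ => _) = fun=> 1); first exact: Ck_cst.
  by apply/funext => x; rewrite big_ord0.
rewrite (_ : (fun _ => _) = fun x => F ord0 x * \prod_(i < n) F (lift ord0 i) x).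
  by apply: CkM => //; exact: IH.
by apply/funext => x; rewrite big_ord_recl.
Qed.

Lemma component_line i j (h : R) (x : point3 R) :
  component j (h *: basis3 R i + x) = h * component j (basis3 R i) + component j x.
Proof. by case: j => [[|[|[|]]]]. Qed.

Lemma continuous_component i : continuous (@component R i).
Proof.
case: i => [[|[|[|//]]]] ilt.
- rewrite (_ : component _ = fst \o fst) // => x.
  by apply: continuous_comp; apply: cvg_fst.
- rewrite (_ : component _ = snd \o fst) // => x.
  by apply: continuous_comp; [apply: cvg_fst|apply: cvg_snd].
- by move=> x; apply: cvg_snd.
Qed.

(** All the derivatives of F 0 are given at once by the sequence F, so that the induction
    on k can pass from F m to F m.+1. *)
Lemma Ck_component k j : Ck k (@component R j).
Proof.
case: k => [|k]; split; try exact: continuous_component; first by [].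
move=> i.
have d x : is_derive x (basis3 R i) (component j) (component j (basis3 R i)).
  by apply: is_derive_affine => h; rewrite component_line.
split; first by move=> x; have [] := d x.
have -> : partial i (component j) = fun=> component j (basis3 R i).
  by apply/funext => x; have [] := d x.
exact: Ck_cst.
Qed.

Lemma Ck_comp k (F : nat -> R -> R) w :
  (forall m (x : R), is_derive x 1 (F m) (F m.+1 x)) ->
  Ck k w -> forall m, Ck k (F m \o w).
Proof.
move=> dF.
have cF m : continuous (F m).
  move=> x; apply: differentiable_continuous; apply/derivable1_diffP.
  by have [] := dF m x.
elim: k => [|k IH] Cw m; have [cw dw] := Cw;
   (split; first by move=> x; apply: continuous_comp; [exact: cw|exact: cF]) => //.
move=> i; have [dwi wi] := dw i.
have d x : is_derive x (basis3 R i) (F m \o w) (F m.+1 (w x) * partial i w x).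
  exact: is_derive_comp.
split; first by move=> x; have [] := d x.
have -> : partial i (F m \o w) = fun x => (F m.+1 \o w) x * partial i w x.
  by apply/funext => x; have [] := d x.
by apply: CkM => //; apply: IH; exact: CkS.
Qed.

Lemma smooth_flat (P : {poly R}) w : smooth w -> smooth (flat P \o w).
Proof.
move=> sw k.
apply: (@Ck_comp k (fun m => flat (iter m (@flat_next R) P)) w _ (sw k) 0%N).
by move=> m x; exact: is_derive_flat.
Qed.

Lemma smooth_derivable i f x : smooth f -> derivable f x (basis3 R i).
Proof. by move=> /(_ 1%N) [_ /(_ i) []]. Qed.

Lemma smooth_continuous f : smooth f -> continuous f.
Proof. by move=> /(_ 0%N) []. Qed.

Lemma smooth_partial i f : smooth f -> smooth (partial i f).
Proof. by move=> sf k; have [_ /(_ i) []] := sf k.+1. Qed.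

(** Omega, U and the complement of the closure of Omega are open and cover the space, and
    on each of them the extension of f by zero coincides with f or with 0.  Partial
    derivatives of f vanish on U too, which lets the argument be iterated. *)
Lemma smooth_patch (Omega U : set (point3 R)) f : open Omega -> open U ->
  boundary Omega `<=` U -> (forall x, U x -> f x = 0) -> smooth f ->
  smooth (patch (fun=> 0) Omega f) /\
  forall i, partial i (patch (fun=> 0) Omega f) = patch (fun=> 0) Omega (partial i f).
Proof.
move=> oO oU bU fU0 sf; set P := patch (fun=> 0) Omega.
pose van (g : point3 R -> R) := forall y, U y -> g y = 0.
have PE (x : point3 R) : (forall g, van g -> \near x, g x = P g x) \/
    (forall g, van g -> \near x, cst 0 x = P g x).
  have [Ox|nOx] := pselect (Omega x).
    left=> g gU; near=> y; have Oy : Omega y by near: y; exact: open_nbhs_nbhs.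
    by rewrite /P/patch mem_set.
  right=> g gU; have [Ux|nUx] := pselect (U x).
    near=> y; have Uy : U y by near: y; exact: open_nbhs_nbhs.
    by rewrite /P/patch; case: ifPn => // _; rewrite gU.
  have ncx : ~ closure Omega x.
    by move=> cx; apply/nUx/bU; split => // /interior_subset.
  near=> y; have cy : (~` closure Omega) y.
    near: y; apply: open_nbhs_nbhs; split => //.
    by apply: closed_openC; exact: closed_closure.
  rewrite /P/patch memNset// => Oy; exact: cy (subset_closure Oy).
have cP g : van g -> continuous g -> continuous (P g).
  move=> gU cg x; have [/(_ g gU) H|/(_ g gU) H] := PE x.
    rewrite /continuous_at -(nbhs_singleton H).
    apply: cvg_trans (cg x); apply: near_eq_cvg.
    exact: H.
  rewrite /continuous_at -(nbhs_singleton H).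
  apply: cvg_trans (@cvg_cst _ 0 _ (nbhs x) _).
  apply: near_eq_cvg; exact: H.
have dU i g y : van g -> U y -> partial i g y = 0.
  move=> gU Uy; rewrite /partial (@near_eq_derive _ _ _ _ (cst 0)) ?derive_cst//.
  near=> z; apply: gU; near: z; exact: open_nbhs_nbhs.
have dP i g : van g ->
    (forall x, derivable g x (basis3 R i)) ->
    (forall x, derivable (P g) x (basis3 R i)) /\ partial i (P g) = P (partial i g).
  move=> gU dg.
  have H x : is_derive x (basis3 R i) (P g) (P (partial i g) x).
    have dgU : van (partial i g) by move=> y; exact: dU.
    have [PEx|PEx] := PE x; apply: (near_eq_is_derive (PEx g gU)).
      by rewrite -(nbhs_singleton (PEx _ dgU)); exact: derivableP.
    by rewrite -(nbhs_singleton (PEx _ dgU)); exact: is_derive_cst.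
  by split; [move=> x; case: (H x)|apply/funext => x; case: (H x)].
split; last by move=> i; have [] := dP i f fU0 (fun x => @smooth_derivable i f x sf).
move=> k; move: (sf k) => {sf}; elim: k f fU0 => [|k IH] f fU [cf df]; split => //; try exact: cP.
move=> i; have [di fi] := df i; have [dPi ->] := dP i f fU di.
by split => //; apply: IH => // y Uy; exact: dU.
Unshelve. all: by end_near. Qed.

End Calculus.

(** * Boxes and Borel sets *)

Section BorelSpace.
Variable R : realType.
Implicit Types f g w : point3 R -> R.
Local Notation borel := (borel3 R).

Lemma measurable_component i : measurable_fun setT (@component R i : borel -> R).
Proof.
case: i => [[|[|[|//]]]] ilt.
- exact: (measurableT_comp measurable_fst measurable_fst).
- exact: (measurableT_comp measurable_snd measurable_fst).
- exact: measurable_snd.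
Qed.

Definition box (a b : 'I_3 -> R) : set (point3 R) :=
  [set x | forall i, a i <= component i x <= b i].

Definition open_box (a b : 'I_3 -> R) : set (point3 R) :=
  [set x | forall i, a i < component i x < b i].

Lemma ord3P (i : 'I_3) : [\/ i = ord0, i = inord 1 | i = ord_max].
Proof.
case: i => [[|[|[|//]]]] p; [apply: Or31|apply: Or32|apply: Or33]; apply/val_inj => //=.
by rewrite inordK.
Qed.

Lemma measurable_open_box a b : measurable (open_box a b : set borel).
Proof.
have -> : open_box a b = \bigcap_(i in [set: 'I_3])
    ((@component R i : borel -> R) @^-1` `]a i, b i[%classic).
  apply/seteqP; split => x /= H i; first by move=> _; rewrite /= in_itv/= H.
  by have := H i I; rewrite /= in_itv.
apply: fin_bigcap_measurable; first exact: finite_finset.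
by move=> i _; rewrite -[X in measurable X]setTI; exact: measurable_component.
Qed.

(** A quadruple of rationals encodes the cube with the first three as centre and the last
    as half side; there are countably many such cubes. *)
Definition rat_center (q : rat * rat * rat * rat) : 'I_3 -> R :=
  fun i => component i (ratr q.1.1.1, ratr q.1.1.2, ratr q.1.2).
Definition rat_lo q i := rat_center q i - ratr q.2.
Definition rat_hi q i := rat_center q i + ratr q.2.

Lemma open_rational_box (A : set (point3 R)) x : open A -> A x ->
  exists q, open_box (rat_lo q) (rat_hi q) x /\ box (rat_lo q) (rat_hi q) `<=` A.
Proof.
move=> oA Ax; have [e /= e0 xeA] : exists2 e : R, 0 < e & ball x e `<=` A.
  by apply/nbhs_ballP; exact: open_nbhs_nbhs.
have /rat_in_itvoo[r] : 0 < e / 2 by rewrite divr_gt0.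
rewrite in_itv/= => /andP[r0 re].
have near_rat (t : R) : exists q : rat, ratr q - ratr r < t < ratr q + ratr r.
  have /rat_in_itvoo[q] : t - ratr r < t + ratr r by lra.
  by rewrite in_itv/= => /andP[q1 q2]; exists q; lra.
have [q1 xq1] := near_rat x.1.1; have [q2 xq2] := near_rat x.1.2.
have [q3 xq3] := near_rat x.2.
have xbox : open_box (rat_lo (q1, q2, q3, r)) (rat_hi (q1, q2, q3, r)) x.
  by move=> i; case: (ord3P i) => ->; rewrite /rat_lo/rat_hi/rat_center/component ?inordK.
exists (q1, q2, q3, r); split => // y yb; apply: xeA.
have close i : `|component i x - component i y| < e.
  have := xbox i; have := yb i; rewrite /rat_lo/rat_hi/= => /andP[? ?] /andP[? ?].
  by rewrite ltr_norml; lra.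
have := close ord0; have := close (inord 1); have := close ord_max.
by rewrite /component !inordK//= => c3 c2 c1; do !split.
Qed.

Lemma open_cover (A : set (point3 R)) : open A ->
  A = \bigcup_q (if pselect (box (rat_lo q) (rat_hi q) `<=` A)
                 then open_box (rat_lo q) (rat_hi q) else set0).
Proof.
move=> oA; apply/seteqP; split => x; last first.
  case=> q _; case: pselect => [H|_] // /= xb.
  by apply: H => i; have /andP[? ?] := xb i; rewrite !ltW.
by move=> /(open_rational_box oA)[q [xq qA]]; exists q => //; case: pselect.
Qed.

Lemma open_measurable3 (A : set (point3 R)) : open A -> measurable (A : set borel).
Proof.
move=> /open_cover ->.
apply: countable_bigcupT_measurable; first exact: countableP.
move=> q; case: pselect => ? /=; [exact: measurable_open_box|exact: measurable0].
Qed.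

Lemma continuous_measurable3 f : continuous f -> measurable_fun setT (f : borel -> R).
Proof.
move=> /continuousP cf; apply: (measurability _ (RGenOpens.measurableE R)).
move=> _ [_ [a [b ->] <-]]; rewrite setTI; apply: open_measurable3.
exact/cf/interval_open.
Qed.

Definition orthant (a : 'I_3 -> R) : set borel :=
  [set x | forall i, a i < component i x].

(** A pi-system generating the Borel sets, whose intersections with an open box are open
    boxes with the same upper corner. *)
Definition orthants : set (set borel) := range orthant.

Lemma orthants_setI_closed : setI_closed orthants.
Proof.
move=> _ _ [a _ <-] [b _ <-]; exists (fun i => Num.max (a i) (b i)) => //.
apply/seteqP; split => x /=.
  by move=> H; split => i; have := H i; rewrite gt_max => /andP[].
by case=> Ha Hb i; rewrite gt_max Ha Hb.
Qed.

(** Each half-space x_i > a is a countable union of orthants whose other corner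
    coordinates tend to minus infinity; hence the coordinates are measurable for the
    sigma-algebra generated by orthants. *)
Lemma borel_generated_by_orthants : @measurable _ borel = <<s orthants >>.
Proof.
pose T := g_sigma_algebraType orthants.
have mc i : measurable_fun setT (@component R i : T -> measurableTypeR R).
  apply: (measurability _ (RGenOInfty.measurableE R)) => _ [_ [a ->] <-].
  rewrite setTI.
  have -> : component i @^-1` `]a, +oo[%classic =
      \bigcup_n orthant (fun j => if j == i then a else - n%:R).
    apply/seteqP; split => x /=; rewrite in_itv/= andbT; last first.
      by case=> n _ /(_ i); rewrite eqxx.
    move=> ax; pose M := \sum_(j < 3) `|component j x|.
    exists (Num.bound M) => // j; case: eqP => [->//|_].
    rewrite ltrNl; apply: (@le_lt_trans _ _ M); last first.
      apply: archi_boundP; exact: sumr_ge0.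
    rewrite /M (bigD1 j)//=.
    have : 0 <= \sum_(k < 3 | k != j) `|component k x| by exact: sumr_ge0.
    by have := ler_norm (- component j x); rewrite normrN; lra.
  apply: bigcupT_measurable => n.
  by apply: sub_sigma_algebra; eexists.
have mid : measurable_fun setT (id : T -> borel).
  have -> : id = (fun x : T => ((component (inord 0) x, component (inord 1) x), component (inord 2) x)) :> (T -> borel).
    by apply/funext => -[[x y] z]; rewrite /component !inordK.
  by apply: measurable_fun_pair; [apply: measurable_fun_pair|]; exact: mc.
apply/seteqP; split.
  by move=> A mA; have := mid measurableT A mA; rewrite setTI.
apply: smallest_sub; first exact: sigma_algebra_measurable.
move=> _ [a _ <-].
have -> : orthant a = \bigcap_(i in [set: 'I_3]) [set x | a i < component i x].
  by apply/seteqP; split => x /= H i; [move=> _|]; exact: H.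
apply: fin_bigcap_measurable; first exact: finite_finset.
move=> i _; rewrite -[X in measurable X]setTI.
have -> : [set x | a i < component i x] = (@component R i : borel -> R) @^-1` `]a i, +oo[%classic.
  by apply/seteqP; split => y /=; rewrite in_itv/= andbT.
exact: measurable_component.
Qed.

Lemma orthant_open_box a b c :
  orthant c `&` open_box a b = open_box (fun i => Num.max (c i) (a i)) b.
Proof.
apply/seteqP; split => x /=.
  by move=> [xc xab] i; have /andP[xa xb] := xab i; rewrite gt_max (xc i) xa xb.
by move=> H; split => i; have := H i; rewrite gt_max => /andP[/andP[? ?] ?] //; apply/andP.
Qed.

End BorelSpace.

(** * Null sets and bounded sets for Lebesgue measure *)

Section NullSlices.
Variable R : realType.
Local Notation mu1 := (@lebesgue_measure R).
Local Notation T1 := (measurableTypeR R).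

Lemma product_measure_swap d1 d2 (T1 : measurableType d1) (T2 : measurableType d2)
    (m1 : {sigma_finite_measure set T1 -> \bar R})
    (m2 : {sigma_finite_measure set T2 -> \bar R}) (X : set (T1 * T2)) :
  measurable X -> (m1 \x m2)%E X = (m1 \x^ m2)%E X.
Proof. by apply: product_measure_unique => A B mA mB; exact: product_measure2E. Qed.

Let leb2_sigma_finite : sigma_finite setT (mu1 \x mu1)%E.
Proof.
have /sigma_finiteP[F [TF ndF Foo]] := sigma_finiteT mu1.
exists (fun n => F n `*` F n).
  rewrite -setXTT [in LHS]TF; apply/seteqP; split => -[x y].
    move=> [/= [n _ Fnx] [k _ Fky]]; exists (maxn n k) => //; split => /=.
      by move: x Fnx; exact/subsetPset/ndF/leq_maxl.
    by move: y Fky; exact/subsetPset/ndF/leq_maxr.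
  by move=> [n _ [/= ? ?]]; split; exists n.
move=> k; have [mF Foo'] := Foo k; split; first exact: measurableX.
by rewrite product_measure1E// lte_mul_pinfty// ge0_fin_numE.
Qed.

Let leb2 : set (T1 * T1)%type -> \bar R := (mu1 \x mu1)%E.
HB.instance Definition _ := Measure.on leb2.
HB.instance Definition _ := Measure_isSigmaFinite.Build _ _ _ leb2 leb2_sigma_finite.

Let lebesgue3_swap (A : set (borel3 R)) : measurable A ->
  lebesgue3 R A = (leb2 \x^ mu1)%E A.
Proof.
move=> mA.
exact: (@product_measure_swap _ _ _ _ leb2 mu1 A mA).
Qed.

(** The measure is computed by integrating first along the direction i, where every
    slice is countable, hence null.  The first two directions are brought to the
    inner position by exchanging the factors of the product measure. *)
Lemma lebesgue3_countable_slices (i : 'I_3) (A : set (borel3 R)) : measurable A ->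
  (forall x : point3 R, countable [set h : R | A (h *: basis3 R i + x)]) ->
  lebesgue3 R A = 0%E.
Proof.
move=> mA cA.
have slice0 (x : point3 R) (B : set R) :
    (forall h, B h -> A (h *: basis3 R i + x)) -> mu1 B = 0%E.
  move=> BA; apply: countable_lebesgue_measure0.
  by apply: sub_countable (cA x); apply: subset_card_le.
have lineE j h (x : point3 R) : h *: basis3 R j + x =
    (h * (j == 0 :> nat)%N%:R + x.1.1, h * (j == 1 :> nat)%N%:R + x.1.2,
     h * (j == 2 :> nat)%N%:R + x.2) by [].
case: i slice0 {cA} => [[|[|[|//]]]] ilt slice0.
- rewrite lebesgue3_swap//.
  apply: integral0_eq => t _ /=.
  rewrite [LHS](@product_measure_swap _ _ _ _ mu1 mu1 (ysection A t)); last first.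
    exact: measurable_ysection.
  apply: integral0_eq => y _ /=; apply: (slice0 ((0, y), t)) => h.
  rewrite /ysection /= ?inE.
  by move/set_mem; rewrite lineE /= !mulr1 !mulr0 !add0r !addr0.
- rewrite lebesgue3_swap//.
  apply: integral0_eq => t _ /=.
  apply: integral0_eq => y _ /=; apply: (slice0 ((y, 0), t)) => h.
  rewrite /xsection /ysection /= ?inE.
  by move/set_mem; rewrite lineE /= !mulr1 !mulr0 !add0r !addr0.
- apply: integral0_eq => y _ /=; apply: (slice0 (y, 0)) => h.
  rewrite /xsection /= ?inE; case: y => y1 y2.
  by rewrite lineE /= !mulr1 !mulr0 !add0r !addr0.
Qed.

End NullSlices.

Section BoundedSets.
Variable R : realType.

Lemma boxE (a b : 'I_3 -> R) : box a b = `[a ord0, b ord0] `*` `[a (inord 1), b (inord 1)] `*` `[a ord_max, b ord_max].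
Proof.
apply/seteqP; split => x.
  move=> H; have := H ord0; have := H (inord 1); have := H ord_max.
  by rewrite /component /= !inordK//= !in_itv.
rewrite /= !in_itv /= => -[[x1 x2] x3] i.
by rewrite /component; case: (ord3P i) => ->; rewrite /= ?inordK.
Qed.

Lemma compact_box (a b : 'I_3 -> R) : compact (box a b).
Proof.
by rewrite boxE; apply: compact_setX; [apply: compact_setX|]; exact: segment_compact.
Qed.

Lemma closed_box (a b : 'I_3 -> R) : closed (box a b).
Proof. by apply: compact_closed; [exact: norm_hausdorff|exact: compact_box]. Qed.

Lemma bounded_in_box (A : set (point3 R)) : bounded_set A ->
  exists M : R, A `<=` box (fun=> - M) (fun=> M).
Proof.
case=> M [_ HM]; exists (M + 1) => x Ax i.
have := HM (M + 1) (ltr_pwDr ltr01 (lexx M)) x Ax.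
rewrite /= !prod_normE /= !ge_max => /andP[/andP[x1 x2] x3].
case: i => [[|[|[|//]]]] ilt; rewrite -ler_norml//.
Qed.

Lemma compact_closure_bounded (A : set (point3 R)) : bounded_set A -> compact (closure A).
Proof.
move=> /bounded_in_box[M AM].
apply: (subclosed_compact _ (@compact_box (fun=> - M) (fun=> M))); first exact: closed_closure.
by rewrite (iffLR (closure_id _) (@closed_box (fun=> - M) (fun=> M))); exact: closure_subset.
Qed.

Lemma bounded_finite_measure (A : set (point3 R)) : bounded_set A ->
  measurable (A : set (borel3 R)) -> (lebesgue3 R A < +oo)%E.
Proof.
move=> /bounded_in_box[M AM] mA.
pose I := `[- M, M]%classic : set (measurableTypeR R).
have mI : measurable I by exact: measurable_itv.
have finI : (lebesgue_measure I < +oo)%E.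
  by rewrite lebesgue_measure_itv /=; case: ifP => _; rewrite ?ltry.
apply: (@le_lt_trans _ _ (lebesgue3 R (I `*` I `*` I))).
  apply: le_measure; rewrite ?inE//.
    by apply: measurableX => //; apply: measurableX.
  by move=> x /AM; rewrite boxE.
rewrite [X in (X < _)%E]product_measure1E//; last exact: measurableX.
rewrite /= product_measure1E//.
by rewrite !lte_mul_pinfty ?mule_ge0 ?fin_numM ?ge0_fin_numE.
Qed.

End BoundedSets.

(** * Square-integrable functions *)

#[local] Instance lebesgue3_ae_filter (R : realType) :
  Filter (nbhs (almost_everywhere (@lebesgue3 R))).
Proof. exact: (@ae_filter_ringOfSetsType _ _ _ (lebesgue3 R)). Qed.

Section SquareIntegrable.
Variables (R : realType) (Omega : set (point3 R)).
Hypothesis mO : measurable (Omega : set (borel3 R)).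
Implicit Types f g : point3 R -> R.

Definition integ f : Prop := (@lebesgue3 R).-integrable Omega (EFin \o f).

Lemma integP f : integ f -> measurable_fun (Omega : set (borel3 R)) (f : borel3 R -> R).
Proof. by case/integrableP => /measurable_EFinP. Qed.

Lemma integ_le f g : measurable_fun (Omega : set (borel3 R)) (f : borel3 R -> R) ->
  integ g -> (forall x, Omega x -> `|f x| <= g x) -> integ f.
Proof.
move=> mf ig fg; apply: (le_integrable mO _ _ ig); first exact/measurable_EFinP.
by move=> x Ox /=; rewrite lee_fin (le_trans (fg x Ox))// ler_norm.
Qed.

Lemma integD f g : integ f -> integ g -> integ (fun x => f x + g x).
Proof.
move=> fi gi; have := integrableD mO fi gi; apply: eq_integrable => // x _.
Qed.

Lemma integZ (c : R) f : integ f -> integ (fun x => c * f x).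
Proof. by move=> fi; have := integrableZl mO c fi; apply: eq_integrable. Qed.

Lemma integ_sum n (F : 'I_n -> point3 R -> R) :
  (forall i, integ (F i)) -> integ (fun x => \sum_(i < n) F i x).
Proof.
elim: n F => [|n IH] F FI.
  rewrite (_ : (fun _ => _) = (fun=> 0)); first exact: integrable0.
  by apply/funext => x; rewrite big_ord0.
rewrite (_ : (fun _ => _) = fun x => F ord0 x + \sum_(i < n) F (lift ord0 i) x).
  by apply: integD => //; exact: IH.
by apply/funext => x; rewrite big_ord_recl.
Qed.

Local Notation I := (integral_on Omega).

Lemma integral_onD f g : integ f -> integ g -> I (fun x => f x + g x) = I f + I g.
Proof. by move=> fi gi; exact: RintegralD. Qed.

Lemma integral_onB f g : integ f -> integ g -> I (fun x => f x - g x) = I f - I g.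
Proof. by move=> fi gi; exact: RintegralB. Qed.

Lemma integral_onZ (c : R) f : integ f -> I (fun x => c * f x) = c * I f.
Proof. by move=> fi; exact: RintegralZl. Qed.

Lemma integral_on_sum n (F : 'I_n -> point3 R -> R) : (forall i, integ (F i)) ->
  I (fun x => \sum_(i < n) F i x) = \sum_(i < n) I (F i).
Proof.
elim: n F => [|n IH] F FI.
  rewrite big_ord0 (_ : (fun _ => _) = (fun=> 0)).
    by rewrite /integral_on Rintegral_cst ?mul0r.
  by apply/funext => x; rewrite big_ord0.
rewrite big_ord_recl -IH// -integral_onD//; last exact: integ_sum.
by congr integral_on; apply/funext => x; rewrite big_ord_recl.
Qed.

Lemma eq_integral_on f g : (forall x, Omega x -> f x = g x) -> I f = I g.
Proof. by move=> fg; apply: eq_Rintegral => x /set_mem; exact: fg. Qed.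

Lemma integral_on_ae0 f : measurable_fun (Omega : set (borel3 R)) (f : borel3 R -> R) ->
  {ae @lebesgue3 R, forall x, Omega x -> f x = 0} -> I f = 0.
Proof.
move=> mf f0; rewrite /integral_on /Rintegral.
rewrite (ae_eq_integral (cst 0%E))//; first by rewrite integral0.
  exact/measurable_EFinP.
by apply: filterS f0 => x /= H Ox; rewrite H.
Qed.

Lemma L2M f g : L2 Omega f -> L2 Omega g -> integ (fun x => f x * g x).
Proof.
move=> [mf f2] [mg g2]; apply: (@integ_le _ (fun x => f x ^+ 2 + g x ^+ 2)).
- exact: measurable_funM.
- exact: integD.
- by move=> x _; rewrite ler_norml; apply/andP; split; nra.
Qed.

Lemma L2D f g : L2 Omega f -> L2 Omega g -> L2 Omega (fun x => f x + g x).
Proof.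
move=> Lf Lg; have [mf f2] := Lf; have [mg g2] := Lg.
have mfg : measurable_fun (Omega : set (borel3 R)) (fun x : borel3 R => f x + g x).
  exact: measurable_funD.
split=> //; apply: (@integ_le _ (fun x => f x ^+ 2 + g x ^+ 2 + 2 * (f x * g x))).
- exact: measurable_funX.
- by apply: integD; [exact: integD|apply: integZ; exact: L2M].
- by move=> x _; rewrite ger0_norm ?sqr_ge0//; lra.
Qed.

Lemma L2Z (c : R) f : L2 Omega f -> L2 Omega (fun x => c * f x).
Proof.
move=> [mf f2]; split; first exact: measurable_funM.
have := integZ (c ^+ 2) f2; congr integ; by apply/funext => x; rewrite exprMn.
Qed.

Lemma L2N f : L2 Omega f -> L2 Omega (fun x => - f x).
Proof.
move=> /(L2Z (-1)); congr (L2 Omega); by apply/funext => x; rewrite mulN1r.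
Qed.

Lemma L2B f g : L2 Omega f -> L2 Omega g -> L2 Omega (fun x => f x - g x).
Proof. by move=> Lf Lg; apply: L2D => //; exact: L2N. Qed.

Lemma L2_bounded (M : R) f : (@lebesgue3 R Omega < +oo)%E ->
  measurable_fun (Omega : set (borel3 R)) (f : borel3 R -> R) ->
  (forall x, Omega x -> `|f x| <= M) -> L2 Omega f.
Proof.
move=> fin mf fM; split => //; apply: (@integ_le _ (fun=> M ^+ 2)).
- exact: measurable_funX.
- apply/integrableP; split; first exact: measurable_cst.
  by rewrite [X in (X < _)%E]integral_cst// lte_mul_pinfty.
- move=> x Ox; rewrite normrX; have := fM x Ox; have := normr_ge0 (f x); nra.
Qed.

Lemma integ_dot n (u v : field R n) : L2vec Omega u -> L2vec Omega v ->
  integ (fun x => dot (u x) (v x)).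
Proof. by move=> Lu Lv; apply: integ_sum => i; exact: L2M. Qed.

Lemma inner_sum n (u v : field R n) : L2vec Omega u -> L2vec Omega v ->
  inner Omega u v = \sum_(i < n) I (fun x => u x i 0 * v x i 0).
Proof. by move=> Lu Lv; apply: integral_on_sum => i; exact: L2M. Qed.

Lemma innerC n (u v : field R n) : inner Omega u v = inner Omega v u.
Proof.
by congr integral_on; apply/funext => x; apply: eq_bigr => i _; exact: mulrC.
Qed.

Lemma innerDl n (u v w : field R n) : L2vec Omega u -> L2vec Omega v -> L2vec Omega w ->
  inner Omega (fun x => u x + v x) w = inner Omega u w + inner Omega v w.
Proof.
move=> Lu Lv Lw; rewrite -integral_onD; try exact: integ_dot.
congr integral_on; apply/funext => x; rewrite -big_split.
by apply: eq_bigr => i _; rewrite mxE mulrDl.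
Qed.

Lemma innerZl n (c : R) (u v : field R n) : L2vec Omega u -> L2vec Omega v ->
  inner Omega (fun x => c *: u x) v = c * inner Omega u v.
Proof.
move=> Lu Lv; rewrite -integral_onZ; last exact: integ_dot.
congr integral_on; apply/funext => x; rewrite /dot mulr_sumr.
by apply: eq_bigr => i _; rewrite mxE mulrA.
Qed.

Lemma innerDr n (u v w : field R n) : L2vec Omega u -> L2vec Omega v -> L2vec Omega w ->
  inner Omega w (fun x => u x + v x) = inner Omega w u + inner Omega w v.
Proof. by move=> *; rewrite innerC innerDl// innerC [inner _ v _]innerC. Qed.

Lemma innerZr n (c : R) (u v : field R n) : L2vec Omega u -> L2vec Omega v ->
  inner Omega v (fun x => c *: u x) = c * inner Omega v u.
Proof. by move=> *; rewrite innerC innerZl// innerC. Qed.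

Lemma inner_ge0 n (u : field R n) : 0 <= inner Omega u u.
Proof.
by apply: Rintegral_ge0 => x _; apply: sumr_ge0 => i _; rewrite -expr2 sqr_ge0.
Qed.

Lemma L2vecD n (u v : field R n) : L2vec Omega u -> L2vec Omega v ->
  L2vec Omega (fun x => u x + v x).
Proof.
move=> Lu Lv i; rewrite (_ : (fun _ => _) = fun x => u x i 0 + v x i 0).
  exact: L2D.
by apply/funext => x; rewrite mxE.
Qed.

Lemma L2vecZ n (c : R) (u : field R n) : L2vec Omega u -> L2vec Omega (fun x => c *: u x).
Proof.
move=> Lu i; rewrite (_ : (fun _ => _) = fun x => c * u x i 0); first exact: L2Z.
by apply/funext => x; rewrite mxE.
Qed.

Lemma L2vecN n (u : field R n) : L2vec Omega u -> L2vec Omega (fun x => - u x).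
Proof.
move=> Lu i; rewrite (_ : (fun _ => _) = fun x => - u x i 0); first exact: L2N.
by apply/funext => x; rewrite mxE.
Qed.

Lemma L2vecB n (u v : field R n) : L2vec Omega u -> L2vec Omega v ->
  L2vec Omega (fun x => u x - v x).
Proof. by move=> Lu Lv; apply: L2vecD => //; exact: L2vecN. Qed.

Lemma dominated_integral_on (f_ : nat -> point3 R -> R) f g :
  (forall n, measurable_fun (Omega : set (borel3 R)) (f_ n : borel3 R -> R)) ->
  measurable_fun (Omega : set (borel3 R)) (f : borel3 R -> R) ->
  {ae @lebesgue3 R, forall x, Omega x -> f_ n x @[n --> \oo] --> f x} ->
  integ g -> (forall n x, Omega x -> `|f_ n x| <= g x) ->
  I (f_ n) @[n --> \oo] --> I f.
Proof.
move=> mf_ mf ff ig fg.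
have [] := @dominated_convergence _ _ _ (@lebesgue3 R) _ mO
   (fun n => EFin \o f_ n) (EFin \o f) (EFin \o g).
- by move=> n; exact/measurable_EFinP.
- exact/measurable_EFinP.
- by apply: filterS ff => x H Ox; apply: cvg_EFin; [exact: nearW|exact: H].
- exact: ig.
- by apply: aeW => x n Ox /=; rewrite lee_fin; exact: fg.
move=> fi _ cvg.
rewrite /integral_on /Rintegral.
by apply: fine_cvg; rewrite fineK//; exact: integrable_fin_num.
Qed.

End SquareIntegrable.

(** * Test functions separate integrable functions *)

Section Bumps.
Variable R : realType.

(** The function exp(-1/t) on t > 0, extended by 0: a smooth step from 0 to 1. *)
Definition theta : R -> R := flat 1.

Lemma theta_le0 (t : R) : t <= 0 -> theta t = 0.
Proof. by move=> t0; rewrite /theta /flat ltNge t0. Qed.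

Lemma theta_ge0 (t : R) : 0 <= theta t.
Proof.
by rewrite /theta /flat; case: ifP => // _; rewrite hornerC mul1r expR_ge0.
Qed.

Lemma theta_le1 (t : R) : theta t <= 1.
Proof.
rewrite /theta /flat; case: ifPn => [t0|_]; last exact: ler01.
rewrite hornerC mul1r -expR0 ler_expR oppr_le0 invr_ge0; exact: ltW.
Qed.

Lemma cvg_theta (u : nat -> R) : (u n)^-1 @[n --> \oo] --> (0 : R) ->
  (\forall n \near \oo, 0 < u n) -> theta (u n) @[n --> \oo] --> (1 : R).
Proof.
move=> u0 up.
apply: (@cvg_trans _ ((fun n => expR (- (u n)^-1)) @ \oo)).
  apply: near_eq_cvg; near=> n.
  have un : 0 < u n by near: n.
  by rewrite /theta /flat un hornerC mul1r.
have e1 : expR (- 0) = 1 :> R by rewrite oppr0 expR0.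
suff : expR (- (u n)^-1) @[n --> \oo] --> expR (- 0 : R) by rewrite e1.
apply: (@cvg_comp _ _ _ (fun n => - (u n)^-1) expR); first exact: cvgN u0.
exact: continuous_expR.
Unshelve. all: by end_near. Qed.

(** Since theta (n t) tends to the indicator of t > 0, these functions converge to the
    indicator of the open box. *)
Definition bump (a b : 'I_3 -> R) (n : nat) (x : point3 R) : R :=
  \prod_(i < 3) (theta (n.+1%:R * (component i x - a i)) *
                 theta (n.+1%:R * (b i - component i x))).

Lemma bump_ge0 a b n x : 0 <= bump a b n x.
Proof. by apply: prodr_ge0 => i _; rewrite mulr_ge0 ?theta_ge0. Qed.

Lemma bump_le1 a b n x : bump a b n x <= 1.
Proof.
apply: prodr_ile1 => i _; rewrite mulr_ge0 ?theta_ge0//=.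
by rewrite mulr_ile1 ?theta_ge0 ?theta_le1.
Qed.

Lemma bump_out a b n x : ~ open_box a b x -> bump a b n x = 0.
Proof.
move=> nx; have [i ni] : exists i, ~ (a i < component i x < b i).
  by apply/existsNP.
rewrite /bump (bigD1 i)//= [X in X * _](_ : _ = 0) ?mul0r//.
apply/eqP; rewrite mulf_eq0; apply/orP.
have [xa|ax] := leP (component i x) (a i).
  by left; rewrite theta_le0// mulr_ge0_le0// subr_le0.
right; rewrite theta_le0// mulr_ge0_le0// subr_le0 leNgt.
by apply/negP => xb; apply: ni; rewrite ax xb.
Qed.

Lemma smooth_bump a b n : smooth (bump a b n).
Proof.
move=> k; apply: Ck_prod => i; apply: CkM.
  apply: (@smooth_flat _ 1 (fun x => n.+1%:R * (component i x - a i))) => m.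
  apply: CkM; first exact: Ck_cst.
  by apply: CkB; [exact: Ck_component|exact: Ck_cst].
apply: (@smooth_flat _ 1 (fun x => n.+1%:R * (b i - component i x))) => m.
apply: CkM; first exact: Ck_cst.
by apply: CkB; [exact: Ck_cst|exact: Ck_component].
Qed.

Lemma cvg_bump a b x : bump a b n x @[n --> \oo] --> (\1_(open_box a b) x : R).
Proof.
rewrite indicE; have [/set_mem xab|nx] := boolP (x \in open_box a b); last first.
  rewrite (_ : (fun _ => _) = (fun=> 0)); first exact: cvg_cst.
  by apply/funext => n; rewrite bump_out// => H; move/negP: nx; apply; exact: mem_set.
have lim1 (t : R) : 0 < t -> theta (n.+1%:R * t) @[n --> \oo] --> (1 : R).
  move=> t0; apply: cvg_theta; last by apply: nearW => n; rewrite mulr_gt0.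
  rewrite (_ : (fun n => _) = (fun n => harmonic n * t^-1)); last first.
    by apply/funext => n; rewrite invfM.
  rewrite -[X in _ --> X](mul0r t^-1).
  by apply: cvgM; [exact: cvg_harmonic|exact: cvg_cst].
have fac i : theta (n.+1%:R * (component i x - a i)) *
      theta (n.+1%:R * (b i - component i x)) @[n --> \oo] --> (1 : R).
  rewrite -[X in _ --> X](mulr1 1); have /andP[xa xb] := xab i.
  by apply: cvgM; apply: lim1; rewrite subr_gt0.
rewrite /bump; under eq_fun do rewrite !big_ord_recl big_ord0 mulr1.
have := cvgM (fac ord0) (cvgM (fac (lift ord0 ord0)) (fac (lift ord0 (lift ord0 ord0)))).
by rewrite !mulr1; apply.
Qed.

Lemma test_bump (Omega : set (point3 R)) a b n : box a b `<=` Omega ->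
  test_function Omega (bump a b n).
Proof.
move=> abO.
have sub : closure [set x | bump a b n x != 0] `<=` box a b.
  rewrite (iffLR (closure_id _) (@closed_box _ a b)); apply: closure_subset.
  move=> x /eqP bx i; have [xo|nx] := pselect (open_box a b x).
    by have /andP[? ?] := xo i; rewrite !ltW.
  by exfalso; apply: bx; rewrite bump_out.
split; first exact: smooth_bump.
- apply: (subclosed_compact _ (@compact_box _ a b)) => //; exact: closed_closure.
- exact: subset_trans abO.
Qed.

End Bumps.

Section FundamentalLemma.
Variables (R : realType) (Omega : set (point3 R)).
Hypothesis oO : open Omega.
Variable d : point3 R -> R.
Hypothesis di : integ Omega d.
Hypothesis d_test : forall phi, test_function Omega phi ->
  integral_on Omega (fun x => d x * phi x) = 0.

Local Notation mu := (@lebesgue3 R).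
Let mO : measurable (Omega : set (borel3 R)) := open_measurable3 oO.

(** Dominated convergence for the bumps of the box. *)
Let integral_open_box a b : box a b `<=` Omega ->
  (\int[mu]_(x in open_box a b) (d x)%:E = 0)%E.
Proof.
move=> abO; have mab := measurable_open_box a b.
have abO' : open_box a b `<=` Omega.
  by move=> x H; apply: abO => i; have /andP[? ?] := H i; rewrite !ltW.
have mind : measurable_fun (Omega : set (borel3 R)) (\1_(open_box a b) : borel3 R -> R).
  exact: measurable_indic.
have := @dominated_integral_on _ Omega mO (fun n x => d x * bump a b n x)
   (fun x => d x * \1_(open_box a b) x) (fun x => `|d x|).
have -> : integral_on Omega (fun x => d x * \1_(open_box a b) x) =
    fine (\int[mu]_(x in open_box a b) (d x)%:E)%E.
  rewrite /integral_on /Rintegral; congr fine.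
  by rewrite -[in RHS](setIidr abO') integral_mkcondr epatch_indic.
move=> /(_ _ _ _ _ _)/cvg_unique H.
have fin : (\int[mu]_(x in open_box a b) (d x)%:E)%E \is a fin_num.
  by apply: integrable_fin_num => //; exact: integrableS di.
rewrite -(fineK fin); congr EFin; apply: H => //.
- move=> n; apply: measurable_funM; first exact: (integP di).
  apply: measurable_funTS; apply: continuous_measurable3.
  exact/smooth_continuous/smooth_bump.
- by apply: measurable_funM => //; exact: (integP di).
- by apply: aeW => x _; apply: cvgM; [exact: cvg_cst|exact: cvg_bump].
- exact: (integrable_norm di).
- move=> n x _; rewrite normrM ler_piMr// ger0_norm ?bump_ge0//; exact: bump_le1.
- rewrite /= (_ : (fun n : nat => _) = (fun=> 0)); first exact: cvg_cst.
  by apply/funext => n; apply: d_test; exact: test_bump.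
Qed.

(** The integral of d over an open box vanishes as soon as the closed box lies in Omega.
    Inside such a box the sets over which d has integral zero form a Dynkin system
    containing the orthants, hence all Borel sets, and so d vanishes almost everywhere in
    the box.  Countably many such boxes cover Omega. *)
Lemma test_function_separating : {ae mu, forall x, Omega x -> d x = 0}.
Proof.
have box0 a b : box a b `<=` Omega -> ae_eq mu (open_box a b) (EFin \o d) (cst 0%E).
  move=> abO; set B := open_box a b.
  have mB : measurable (B : set (borel3 R)) := measurable_open_box a b.
  have BO : B `<=` Omega.
    by move=> x H; apply: abO => i; have /andP[? ?] := H i; rewrite !ltW.
  have iB : mu.-integrable B (EFin \o d) by exact: integrableS di.
  pose H := [set A : set (borel3 R) | measurable A /\ (\int[mu]_(x in A `&` B) (d x)%:E = 0)%E].
  have HA : measurable `<=` H.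
    rewrite borel_generated_by_orthants; apply: lambda_system_subset => //.
    - exact: orthants_setI_closed.
    - apply/dynkin_lambda_system; split.
      + split; first exact: measurableT.
        by rewrite setTI; exact: integral_open_box.
      + move=> A [mA A0]; split; first exact: measurableC.
        have := integral_open_box abO; rewrite -/B.
        have {1}-> : B = (A `&` B) `|` (~` A `&` B) by rewrite -setIUl setUv setTI.
        rewrite integral_setU ?A0 ?add0e//.
        * exact: measurableI.
        * by apply: measurableI => //; exact: measurableC.
        * by rewrite -setIUl setUv setTI; case/integrableP: iB.
        * by apply/disj_setPS => x [[Ax _] [nAx _]].
      + move=> F tF HF; split.
          by apply: bigcupT_measurable => n; have [] := HF n.
        rewrite setI_bigcupl integral_bigcup.
        * by rewrite eseries0// => n _ _; have [] := HF n.
        * exact: trivIset_setIr.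
        * by move=> n; apply: measurableI => //; have [] := HF n.
        * apply: (integrableS mB) => //.
            by apply: bigcupT_measurable => n; apply: measurableI => //; have [] := HF n.
          by move=> x [n _ []].
    - move=> _ [c _ <-]; split.
        by rewrite borel_generated_by_orthants; apply: sub_sigma_algebra; exists c.
      rewrite orthant_open_box; apply: integral_open_box => x xab; apply: abO => i.
      by have := xab i; rewrite ge_max => /andP[/andP[_ ->] ->].
  apply: integral_ae_eq => // E EB mE.
  by have [_] := HA E mE; rewrite integral0 (setIidl EB).
pose F k := if unpickle k is Some q then
   if pselect (box (rat_lo R q) (rat_hi R q) `<=` Omega) then
     ~` [set x | open_box (rat_lo R q) (rat_hi R q) x -> (EFin \o d) x = cst (0 : \bar R)%E x]
     else set0 else set0 : set (borel3 R).
have : mu.-negligible (\bigcup_k F k).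
  apply: negligible_bigcup => k; rewrite /F.
  case: unpickle => [q|]; last exact: negligible_set0.
  case: pselect => [qO|_] /=; last exact: negligible_set0.
  exact: box0.
apply: negligibleS => x /= /not_implyP[Ox dx].
have [q [xq qO]] := open_rational_box oO Ox.
have Fq : F (pickle q) = ~` [set x | open_box (rat_lo R q) (rat_hi R q) x ->
    (EFin \o d) x = cst (0 : \bar R)%E x].
  by rewrite /F pickleK; case: pselect.
exists (pickle q); first exact: I.
rewrite Fq => /(_ xq) [].
exact: dx.
Qed.

End FundamentalLemma.

(** * The gradient on a level set *)

Section LevelSet.
Variable R : realType.
Implicit Types w : point3 R -> R.

(** If no point of Z other than h is within 1/(n+1) of h, the pair of n and of the integer
    part of (n+1) h determines h; so S injects into a countable type. *)
Lemma countable_isolated (S Z : set R) : S `<=` Z ->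
  (forall h, S h -> exists2 e : R, 0 < e & forall t, Z t -> `|t - h| < e -> t = h) ->
  countable S.
Proof.
move=> SZ isoS.
have /boolp.choice[n Hn] : forall h, exists m : nat, S h ->
    forall t, Z t -> `|t - h| < m.+1%:R^-1 -> t = h.
  move=> h; have [Sh|nSh] := pselect (S h); last by exists 0%N.
  have [e e0 He] := isoS h Sh; exists (Num.trunc e^-1) => _ t Zt th.
  apply: He => //; apply: (lt_le_trans th).
  rewrite -[leRHS]invrK lef_pV2 ?posrE ?invr_gt0// ltW//.
  by have /andP[] := trunc_itv (ltW (etrans (invr_gt0 e) e0)).
pose f h := pickle (n h, Num.floor (h * (n h).+1%:R)).
apply/countable_injP; exists f => h h' /set_mem Sh /set_mem Sh'.
move=> /(pcan_inj pickleK)[nn]; rewrite -nn => ff.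
apply: (Hn h' Sh' h (SZ _ Sh)); rewrite -nn.
have np : 0 < (n h).+1%:R :> R by [].
have /andP[a1 a2] := floor_itv (h * (n h).+1%:R).
have := floor_itv (h' * (n h).+1%:R); rewrite -ff => /andP[b1 b2].
move: a2 b2; rewrite intrD => a2 b2.
rewrite -[ltRHS]mul1r ltr_pdivlMr// -[X in _ * X](ger0_norm (ltW np)) -normrM.
rewrite ltr_norml mulrBl; lra.
Qed.

(** Along a line directed by the i-th basis vector, a zero of w at which the i-th partial
    derivative is nonzero is an isolated zero.  The exceptional set therefore has
    countable slices. *)
Lemma partial0_on_level_set w i : smooth w ->
  {ae @lebesgue3 R, forall x, w x = 0 -> partial i w x = 0}.
Proof.
move=> sw; have cw := smooth_continuous sw.
have cp := smooth_continuous (smooth_partial i sw).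
pose A : set (borel3 R) := [set x | w x = 0 /\ partial i w x <> 0].
have mA : measurable A.
  have -> : A = ((w : borel3 R -> R) @^-1` [set 0]) `&`
      ~` ((partial i w : borel3 R -> R) @^-1` [set 0]) by [].
  apply: measurableI.
    by rewrite -[X in measurable X]setTI; apply: continuous_measurable3.
  apply: measurableC.
  by rewrite -[X in measurable X]setTI; apply: continuous_measurable3.
have A0 : lebesgue3 R A = 0%E.
  apply: (lebesgue3_countable_slices (i := i) mA) => x.
  apply: (@countable_isolated _ [set h | w (h *: basis3 R i + x) = 0]).
    by move=> h [].
  move=> h [/= wh dh]; set y : point3 R := h *: basis3 R i + x in wh dh.
  have dwy : derivable w y (basis3 R i) := smooth_derivable sw.
  have /cvgr_neq0 : t^-1 *: ((w \o shift y) (t *: basis3 R i) - w y) @[t --> 0^'] -->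
      partial i w y by exact: dwy.
  have dh' : partial i w y != 0 by exact/eqP.
  move=> /(_ dh'); rewrite /dnbhs /= => /nbhs_ballP[e /= e0 He].
  exists e => // t wt th; apply/eqP; rewrite -subr_eq0; apply: contraT => tn0.
  have := He (t - h); rewrite /ball /= sub0r normrN => /(_ th tn0).
  by rewrite wh /y addrA -scalerDl subrK wt subrr scaler0 eqxx.
exists A; split => // x /= /not_implyP[]; by [].
Qed.

End LevelSet.

(** * Truncation near the zeros of a function *)

Section Truncation.
Variable R : realType.
Implicit Types w : point3 R -> R.

Definition theta' : R -> R := flat (flat_next 1).

(** Negative exactly when |s| < 1/(n+1), and tending to infinity with n for s nonzero. *)
Definition trunc_arg (n : nat) (s : R) : R := n.+1%:R * (s * s) - harmonic n.

(** The derivative of s theta(trunc_arg n s), where (n+1) s^2 is written as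
    trunc_arg n s + 1/(n+1). *)
Definition trunc_slope (n : nat) (s : R) : R :=
  theta (trunc_arg n s) +
  2 * (trunc_arg n s + harmonic n) * theta' (trunc_arg n s).

Lemma trunc_slopeE n s : let u := (trunc_arg n s)^-1 in 0 < trunc_arg n s ->
  trunc_slope n s = (1 + 2 * u + 2 * harmonic n * u ^+ 2) * expR (- u).
Proof.
rewrite /trunc_slope /theta' /theta /flat /flat_next.
move: (trunc_arg n s) (harmonic n) => y c y0; rewrite y0.
rewrite hornerM hornerXn hornerD hornerN -(polyC1 R) derivC horner0 hornerC subr0.
by field; exact: lt0r_neq0.
Qed.

(** In terms of u = 1 / trunc_arg n s the slope is a polynomial in u with bounded
    coefficients times exp(-u); this uniform bound is the domination used in the limit
    n to infinity. *)
Lemma trunc_slope_bounded : exists C : R, forall n s, `|trunc_slope n s| <= C.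
Proof.
have [C HC] := @poly_expRN_bounded R (1 + 2%:P * 'X + 2%:P * 'X^2).
(* The coefficient 1/(n+1) of u^2 in the slope is at most 1; the maximum with 0 covers
   the points where the slope is 0. *)
exists (Num.max C 0) => n s; rewrite le_max.
have [y0|y0] := leP (trunc_arg n s) 0.
  rewrite /trunc_slope theta_le0// /theta' /flat ltNge y0 /= mulr0 addr0 normr0.
  by rewrite lexx orbT.
apply/orP; left; rewrite trunc_slopeE//.
have u0 : 0 < (trunc_arg n s)^-1 by rewrite invr_gt0.
set u := _^-1 in u0 *.
rewrite normrM (ger0_norm (expR_ge0 _)); apply: le_trans (HC u u0).
rewrite ler_wpM2r ?expR_ge0//.
rewrite !hornerD !hornerM !hornerC !hornerX expr2.
have h1 : harmonic n <= 1 :> R by rewrite /harmonic /= invf_le1 ?ler1n ?ltr0n.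
have h0 : 0 <= harmonic n :> R by exact: harmonic_ge0.
have u2 : 0 <= u * u by rewrite mulr_ge0 ?(ltW u0).
rewrite !ger0_norm; nra.
Qed.

(** Here the argument of theta tends to infinity, so its inverse u tends to 0 in
    [trunc_slopeE]. *)
Lemma cvg_trunc_slope (s : R) : s != 0 -> trunc_slope n s @[n --> \oo] --> (1 : R).
Proof.
move=> s0; have ss : 0 < s * s by rewrite -expr2 exprn_even_gt0.
have hc := @cvg_harmonic R.
have dc : (s * s - harmonic n * harmonic n) @[n --> \oo] --> s * s.
  rewrite -[X in _ --> X]subr0 -[X in _ --> _ - X](mulr0 0).
  by apply: cvgB; [exact: cvg_cst|exact: cvgM].
have argE n : trunc_arg n s = n.+1%:R * (s * s - harmonic n * harmonic n).
  by rewrite /trunc_arg /harmonic /=; field.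
have uc : (trunc_arg n s)^-1 @[n --> \oo] --> (0 : R).
  rewrite (_ : (fun n => _) = fun n => harmonic n * (s * s - harmonic n * harmonic n)^-1).
    rewrite -[X in _ --> X](mul0r (s * s)^-1); apply: cvgM => //.
    by apply: cvgV dc; exact: lt0r_neq0.
  by apply/funext => n; rewrite argE invfM.
have yp : \forall n \near \oo, 0 < trunc_arg n s.
  have Hs : \forall n \near \oo, 0 < s * s - harmonic n * harmonic n by exact: cvgr_gt dc _ ss.
  near=> n; have Hn : 0 < s * s - harmonic n * harmonic n by near: n.
  by rewrite argE mulr_gt0.
apply: (@cvg_trans _ ((fun n => (1 + 2 * (trunc_arg n s)^-1 +
    2 * harmonic n * (trunc_arg n s)^-1 ^+ 2) * theta (trunc_arg n s)) @ \oo)).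
  apply: near_eq_cvg; near=> n.
  have yn : 0 < trunc_arg n s by near: n.
  by rewrite trunc_slopeE//= /theta /flat yn hornerC mul1r.
have th := cvg_theta uc yp.
have H : (1 + 2 * (trunc_arg n s)^-1 +
    2 * harmonic n * (trunc_arg n s)^-1 ^+ 2) @[n --> \oo] -->
    (1 + 2 * 0 + 2 * 0 * 0 ^+ 2 : R).
  apply: cvgD; first by apply: cvgD; [exact: cvg_cst|apply: cvgMr].
  apply: cvgM; first exact: cvgMr.
  by rewrite expr2; under eq_fun do rewrite expr2; exact: cvgM.
have := cvgM H th.
by rewrite !mulr0 !mul0r !addr0 mulr1; apply.
Unshelve. all: by end_near. Qed.

(** A smooth truncation of w that vanishes where |w| < 1/(n+1); as n grows it and its
    gradient converge to w and to the gradient of w, the latter where w is nonzero. *)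
Definition trunc_fun w n (x : point3 R) : R := w x * theta (trunc_arg n (w x)).

Lemma smooth_trunc_arg w n : smooth w -> smooth (fun x => trunc_arg n (w x)).
Proof.
move=> sw k; apply: CkB; last exact: Ck_cst.
by apply: CkM; [exact: Ck_cst|apply: CkM].
Qed.

Lemma smooth_trunc_fun w n : smooth w -> smooth (trunc_fun w n).
Proof.
move=> sw k; apply: CkM => //.
by apply: (@smooth_flat _ 1 (fun x => trunc_arg n (w x))); exact: smooth_trunc_arg.
Qed.

Lemma is_derive_trunc n (s : R) :
  is_derive s 1 (fun s => s * theta (trunc_arg n s)) (trunc_slope n s).
Proof.
have da : is_derive s 1 (trunc_arg n) (n.+1%:R * (s + s)).
  have d1 := @is_deriveM R R id id s 1 1 1 (is_derive_id s 1) (is_derive_id s 1).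
  have d2 := @is_deriveZ R R R (id * id) n.+1%:R s 1 _ d1.
  have d3 := @is_deriveB R R R _ (cst (harmonic n)) s 1 _ _ d2 (is_derive_cst _ s 1).
  apply: is_derive_eq d3 _.
  by rewrite /GRing.scale /= subr0 !mulr1.
have dt := @is_derive1_comp R (@theta R) (trunc_arg n) s _ _ (is_derive_flat 1 (trunc_arg n s)) da.
have dp := @is_deriveM R R id (@theta R \o trunc_arg n) s 1 _ _ (is_derive_id s 1) dt.
apply: is_derive_eq dp _.
rewrite /GRing.scale /= /trunc_slope.
have -> : trunc_arg n s + harmonic n = n.+1%:R * (s * s) by rewrite /trunc_arg subrK.
rewrite -/theta'; ring.
Qed.

Lemma partial_trunc_fun w n i x : smooth w ->
  partial i (trunc_fun w n) x = trunc_slope n (w x) * partial i w x.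
Proof.
move=> sw; have dw : derivable w x (basis3 R i) := smooth_derivable sw.
by have [] := is_derive_comp dw (is_derive_trunc n (w x)).
Qed.

End Truncation.

(** * Fields without divergence, and functions without trace *)

Section WeakDivergenceFree.
Variables (R : realType) (Omega : set (point3 R)).
Hypotheses (oO : open Omega) (bO : bounded_set Omega).
Implicit Types (w f : point3 R -> R) (h : field R 3).
Let mO : measurable (Omega : set (borel3 R)) := open_measurable3 oO.
Let finO : (@lebesgue3 R Omega < +oo)%E := bounded_finite_measure bO mO.

(** A continuous function is bounded on the compact closure of Omega. *)
Lemma L2_smooth f : smooth f -> L2 Omega f.
Proof.
move=> sf; have cf := smooth_continuous sf.
have cK := compact_closure_bounded bO.
have : compact (f @` closure Omega).
  by apply: continuous_compact => //; apply: continuous_subspaceT.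
move=> /compact_bounded[M [_ HM]].
apply: (@L2_bounded _ _ mO (M + 1)) => //.
  by apply: measurable_funTS; exact: continuous_measurable3.
move=> x Ox; apply: (HM (M + 1)); first by rewrite ltrDl.
by exists x => //; exact: subset_closure.
Qed.

Lemma L2vec_grad f : smooth f -> L2vec Omega (grad f).
Proof.
move=> sf i; rewrite (_ : (fun _ => _) = partial i f).
  exact/L2_smooth/smooth_partial.
by apply/funext => x; rewrite mxE.
Qed.

Lemma test_partial i phi : test_function Omega phi -> test_function Omega (partial i phi).
Proof.
move=> [sp cp pO].
have sub : closure [set x | partial i phi x != 0] `<=` closure [set x | phi x != 0].
  rewrite (iffLR (closure_id _) (@closed_closure _ [set x | phi x != 0])).
  apply: closure_subset => x /eqP dx; apply: contrapT => nc; apply: dx.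
  rewrite /partial (@near_eq_derive _ _ _ phi (cst 0)) ?derive_cst//.
  near=> y; apply/eqP; have : (~` closure [set x | phi x != 0]) y.
    near: y; apply: open_nbhs_nbhs; split => //.
    by apply: closed_openC; exact: closed_closure.
  by move=> ny; apply: contraT => py; exfalso; apply/ny/subset_closure.
split; first exact: smooth_partial.
  by apply: (subclosed_compact _ cp sub); exact: closed_closure.
exact: subset_trans pO.
Unshelve. all: by end_near. Qed.

Lemma smooth_trunc_slope w n : smooth w -> smooth (fun x => trunc_slope n (w x)).
Proof.
move=> sw k; have sa := smooth_trunc_arg n sw; apply: CkD.
  exact: (@smooth_flat _ 1 (fun x => trunc_arg n (w x)) sa k).
apply: CkM; last exact: (@smooth_flat _ (flat_next 1) (fun x => trunc_arg n (w x)) sa k).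
apply: CkM; first exact: Ck_cst.
by apply: CkD; [exact: sa|exact: Ck_cst].
Qed.

(** If w vanishes on the boundary, its truncation vanishes near the boundary, so its
    restriction to Omega extends by zero to a smooth function.  The support of the
    extension lies in the compact set of points of the closure of Omega where
    |w| >= 1/(n+1), which misses the boundary. *)
Lemma test_trunc w n : smooth w -> (forall x, boundary Omega x -> w x = 0) ->
  test_function Omega (patch (fun=> 0) Omega (trunc_fun w n)) /\
  forall x, Omega x -> grad (patch (fun=> 0) Omega (trunc_fun w n)) x =
                       trunc_slope n (w x) *: grad w x.
Proof.
move=> sw wb; have st := smooth_trunc_fun n sw.
have ca : continuous (fun x => trunc_arg n (w x)).
  exact/smooth_continuous/smooth_trunc_arg.
pose U : set (point3 R) := [set x | trunc_arg n (w x) < 0].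
have oU : open U.
  have -> : U = (fun x => trunc_arg n (w x)) @^-1` `]-oo, 0[%classic.
    by apply/seteqP; split => x; rewrite /U /= in_itv.
  by apply: open_comp => //; exact: interval_open.
have bU : boundary Omega `<=` U.
  by move=> x /wb wx; rewrite /U /= /trunc_arg wx !mulr0 sub0r oppr_lt0 harmonic_gt0.
have tU x : U x -> trunc_fun w n x = 0.
  by move=> Ux; rewrite /trunc_fun theta_le0 ?mulr0// ltW.
have [sP dP] := smooth_patch oO oU bU tU st.
split; last first.
  move=> x Ox; apply/colP => i; rewrite !mxE dP /patch mem_set//.
  exact: partial_trunc_fun.
have sub : [set x | patch (fun=> 0) Omega (trunc_fun w n) x != 0] `<=` closure Omega `&` ~` U.
  move=> x /=; rewrite /patch; case: ifPn => [/set_mem Ox|]; last by rewrite eqxx.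
  by move=> /eqP tx; split; [exact: subset_closure|move=> /tU].
have cl : closed (closure Omega `&` ~` U).
  by apply: closedI; [exact: closed_closure|exact: open_closedC].
have subc : closure [set x | patch (fun=> 0) Omega (trunc_fun w n) x != 0] `<=` closure Omega `&` ~` U.
  by rewrite (iffLR (closure_id _) cl); exact: closure_subset.
split => //.
  apply: (subclosed_compact _ (compact_closure_bounded bO)); first exact: closed_closure.
  by move=> x /subc[].
move=> x /subc[cx nUx]; apply: contrapT => nOx; apply/nUx/bU; split => //.
by move=> /interior_subset.
Qed.

Lemma L2_integ f : L2 Omega f -> integ Omega f.
Proof.
move=> Lf; have L1 : L2 Omega (fun=> 1) by apply: L2_smooth => k; exact: Ck_cst.
have := L2M mO Lf L1; congr integ; by apply/funext => x; rewrite mulr1.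
Qed.

Lemma integral_on_test_eq0 f d : L2 Omega f -> L2 Omega d ->
  (forall phi, test_function Omega phi -> integral_on Omega (fun x => d x * phi x) = 0) ->
  integral_on Omega (fun x => f x * d x) = 0.
Proof.
move=> Lf Ld dt; have d0 := test_function_separating oO (L2_integ Ld) dt.
apply: integral_on_ae0 => //; first exact: integP (L2M mO Lf Ld).
by apply: filterS d0 => x d0 Ox; rewrite d0 ?mulr0.
Qed.

(** Two weak gradients of f have the same integrals against test functions, hence agree
    almost everywhere in Omega. *)
Lemma inner_weak_gradient_unique f (Df Df' u : field R 3) : L2vec Omega u ->
  has_grad Omega f Df -> has_grad Omega f Df' -> inner Omega Df u = inner Omega Df' u.
Proof.
move=> Lu [_ LD gD] [_ LD' gD'].
rewrite !(inner_sum mO)//; apply: eq_bigr => i _.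
apply/eqP; rewrite -subr_eq0 -integral_onB//; try exact: L2M.
apply/eqP; rewrite -[RHS](@integral_on_test_eq0 (fun x => u x i 0) (fun x => Df x i 0 - Df' x i 0)).
- by congr integral_on; apply/funext => x; rewrite mulrBr !(mulrC (u x i 0)).
- exact: Lu.
- by apply: L2B.
move=> phi tphi; have Lphi : L2 Omega phi by apply: L2_smooth; case: tphi.
under eq_fun do rewrite mulrBl.
rewrite integral_onB//; try by apply: L2M => //; exact: LD || exact: LD'.
have := gD phi tphi i; rewrite (gD' phi tphi i) => /oppr_inj ->.
by rewrite subrr.
Qed.

(** The partial derivatives of a test function phi are test functions, so the definition of
    the weak gradient applied to each of them gives
    - <grad lambda, grad phi> = <lambda, Delta phi>, which cancels <g, grad phi>. *)
Lemma weakly_divergence_free (g : field R 3) (lambda : point3 R -> R)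
    (Dlambda : field R 3) :
  L2vec Omega g -> has_grad Omega lambda Dlambda ->
  (forall phi, test_function Omega phi ->
     distr_laplacian Omega lambda phi = distr_div Omega g phi) ->
  forall phi, test_function Omega phi ->
    inner Omega (fun x => g x - Dlambda x) (grad phi) = 0.
Proof.
move=> Lg [Ll LD gD] gl phi tphi.
have [sphi _ _] := tphi; have Lgrad := L2vec_grad sphi.
have LN : L2vec Omega (fun x => (-1) *: Dlambda x) by exact: L2vecZ.
have -> : (fun x => g x - Dlambda x) = (fun x => g x + (-1) *: Dlambda x).
  by apply/funext => x; rewrite scaleN1r.
rewrite innerDl// innerZl// -[inner Omega g _]opprK.
rewrite -[- inner Omega g _]/(distr_div Omega g phi) -gl// /distr_laplacian.
have -> : (fun x => lambda x * \sum_(i < 3) partial i (partial i phi) x) =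
    (fun x => \sum_(i < 3) lambda x * partial i (partial i phi) x).
  by apply/funext => x; rewrite mulr_sumr.
rewrite integral_on_sum//; last first.
  by move=> i; apply: L2M => //; apply: L2_smooth; do 2!apply: smooth_partial.
rewrite (inner_sum mO)// mulr_sumr -sumrN -big_split big1// => i _ /=.
rewrite (gD _ (test_partial i tphi)) opprK mulN1r.
apply/eqP; rewrite subr_eq0; apply/eqP; congr integral_on.
by apply/funext => x; rewrite [in RHS]mxE.
Qed.

Variable h : field R 3.
Hypothesis Lh : L2vec Omega h.
Hypothesis h_test : forall phi, test_function Omega phi -> inner Omega h (grad phi) = 0.

(** The truncations of w are test functions with gradient trunc_slope n (w) grad w, and
    these gradients are orthogonal to h.  Let n tend to infinity by dominated convergence:
    the slopes tend to 1 where w is nonzero, and grad w is zero almost everywhere on the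
    set w = 0. *)
Lemma orthogonal_vanishing_boundary w : smooth w ->
  (forall x, boundary Omega x -> w x = 0) -> inner Omega h (grad w) = 0.
Proof.
move=> sw wb; have Lg := L2vec_grad sw.
have idot := integ_dot mO Lh Lg.
have [C HC] := trunc_slope_bounded R.
have H : integral_on Omega (fun x => trunc_slope n (w x) * dot (h x) (grad w x))
     @[n --> \oo] --> inner Omega h (grad w).
  apply: (dominated_integral_on mO (g := fun x => C * `|dot (h x) (grad w x)|)).
  - move=> n; apply: measurable_funM; last exact: integP idot.
    apply: measurable_funTS; apply: continuous_measurable3.
    exact/smooth_continuous/smooth_trunc_slope.
  - exact: integP idot.
  - have H0 := partial0_on_level_set ord0 sw.
    have H1 := partial0_on_level_set (inord 1) sw.
    have H2 := partial0_on_level_set ord_max sw.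
    apply: filterS3 H0 H1 H2 => x h0 h1 h2 Ox.
    have [w0|wn0] := eqVneq (w x) 0.
      have -> : dot (h x) (grad w x) = 0.
        apply: big1 => i _; rewrite mxE.
        by case: (ord3P i) => ->; rewrite ?(h0 w0) ?(h1 w0) ?(h2 w0) mulr0.
      under eq_fun do rewrite mulr0; exact: cvg_cst.
    rewrite -[X in _ --> X]mul1r; apply: cvgM; last exact: cvg_cst.
    exact: cvg_trunc_slope.
  - by apply: integZ => //; exact: integrable_norm idot.
  - by move=> n x Ox; rewrite normrM ler_wpM2r.
apply: (cvg_unique _ H) => //.
rewrite (_ : (fun n => _) = (fun=> 0)); first exact: cvg_cst.
apply/funext => n; have [tt tg] := test_trunc n sw wb.
rewrite -(h_test tt); apply: eq_integral_on => x Ox; rewrite tg// /dot mulr_sumr.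
by apply: eq_bigr => i _; rewrite [in RHS]mxE mulrCA.
Qed.

Lemma inner_quadratic (u v : field R 3) (s : R) : L2vec Omega u -> L2vec Omega v ->
  inner Omega (fun x => u x + s *: v x) (fun x => u x + s *: v x) =
  inner Omega u u + 2 * s * inner Omega u v + s ^+ 2 * inner Omega v v.
Proof.
move=> Lu Lv; have Lsv : L2vec Omega (fun x => s *: v x) by exact: L2vecZ.
rewrite innerDl// ?innerZl// ?innerDr// ?innerZr//; first by rewrite [inner Omega v u]innerC; ring.
all: exact: L2vecD.
Qed.

(** Let c = <u, h>.  Since |v + s h|^2 >= 0 with |v| arbitrarily small and <v, h> = c, one
    gets 2 s c + s^2 |h|^2 >= 0 for every real s, which forces c = 0. *)
Lemma inner_approx_eq0 (u : field R 3) : L2vec Omega u ->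
  (forall e : R, 0 < e -> exists v, [/\ L2vec Omega v,
     inner Omega v h = inner Omega u h & inner Omega v v <= e]) ->
  inner Omega u h = 0.
Proof.
move=> Lu approx; set c := inner Omega u h; set H := inner Omega h h.
have H0 : 0 <= H by exact: inner_ge0.
(* Nearly the minimizer - c / H of 2 s c + s^2 H, but defined also when H = 0. *)
pose s := - c / (H + 1).
have : 0 <= 2 * s * c + s ^+ 2 * H.
  apply/ler_addgt0Pl => e e0; have [v [Lv vh ve]] := approx e e0.
  have := inner_ge0 Omega (fun x => v x + s *: h x).
  by rewrite inner_quadratic// vh -/c -/H; lra.
have -> : 2 * s * c + s ^+ 2 * H = - ((c / (H + 1)) ^+ 2 * (H + 2)).
  by rewrite /s; field; rewrite gt_eqF// ltr_wpDl.
rewrite oppr_ge0 => cH.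
have : (c / (H + 1)) ^+ 2 * (H + 2) == 0.
  by rewrite eq_le cH/= mulr_ge0 ?sqr_ge0// addr_ge0.
rewrite mulf_eq0 expf_eq0 /= mulf_eq0 invr_eq0.
rewrite (gt_eqF (ltr_wpDl H0 ltr01)) (gt_eqF (ltr_wpDl H0 (ltr0Sn R 1))) !orbF.
by move/eqP.
Qed.

Lemma H1norm_inner_le f (Df : field R 3) (e : R) : H1norm Omega f Df < e ->
  inner Omega Df Df <= e ^+ 2.
Proof.
rewrite /H1norm => fe.
have A0 : 0 <= integral_on Omega (fun x => f x ^+ 2).
  by apply: Rintegral_ge0 => x _; exact: sqr_ge0.
have B0 := inner_ge0 Omega Df.
have AB0 := addr_ge0 A0 B0.
have := sqr_sqrtr AB0; have := sqrtr_ge0 (integral_on Omega (fun x => f x ^+ 2) + inner Omega Df Df).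
nra.
Qed.

Lemma gradB f w x : smooth f -> smooth w -> grad (fun x => f x - w x) x = grad f x - grad w x.
Proof.
move=> sf sw; apply/colP => i; rewrite !mxE partialB// => y; exact: smooth_derivable.
Qed.

(** Some smooth phi is close to f in H^1 and has boundary values of small H^{1/2} norm:
    there is a smooth v with the same boundary values as phi and small H^1 norm.  Then
    phi - v vanishes on the boundary, so its gradient is orthogonal to h, and it is still
    close to f in H^1. *)
Lemma zero_trace_orthogonal f : zero_trace Omega f ->
  exists2 Df, has_grad Omega f Df & inner Omega Df h = 0.
Proof.
move=> [Df hDf [phi [sphi cvg1 cvg2]]]; exists Df => //.
have [_ LDf _] := hDf.
apply: inner_approx_eq0 => // e e0.
(* Both gradient errors below have square norm at most d^2, and |a - b|^2 is at most
   2 |a|^2 + 2 |b|^2, so 4 d^2 <= e suffices; d <= 1 gives d^2 <= d. *)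
pose d := Num.min 1 (e / 4).
have d0 : 0 < d by rewrite lt_min ltr01 divr_gt0.
have d1 : 4 * d ^+ 2 <= e.
  have : d <= 1 by rewrite ge_min lexx.
  have : d <= e / 4 by rewrite ge_min lexx orbT.
  nra.
have N1 : \forall n \near \oo, H1norm Omega (phi n \- f) (grad (phi n) \- Df) < d.
  exact: cvgr_lt cvg1 _ d0.
have N2 : \forall n \near \oo, Hhalf_norm Omega (phi n) < d by exact: cvgr_lt cvg2 _ d0.
have [n [n1 n2]] := filter_ex (filterI N1 N2).
have [_ [v [sv vphi] <-] vd] : exists2 y,
    [set H1norm Omega v (grad v) | v in [set v | smooth v /\
       forall x, boundary Omega x -> v x = phi n x]] y & y < d.
  apply: inf_lt n2.
  by exists (H1norm Omega (phi n) (grad (phi n))), (phi n).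
pose w x := phi n x - v x.
have sw : smooth w by move=> k; apply: CkB; [exact: sphi|exact: sv].
have wb x : boundary Omega x -> w x = 0 by move=> /vphi vx; rewrite /w vx subrr.
have Lw := L2vec_grad sw; have Lv := L2vec_grad sv; have Lphi := L2vec_grad (sphi n).
exists (fun x => Df x - grad w x); split.
- exact: L2vecB.
- rewrite innerDl//; last exact: L2vecN.
  rewrite (_ : inner Omega (fun x => - grad w x) h = 0) ?addr0//.
  transitivity (inner Omega (fun x => (-1) *: grad w x) h).
    by congr inner; apply/funext => x; rewrite scaleN1r.
  by rewrite innerZl// innerC orthogonal_vanishing_boundary// mulr0.
have La : L2vec Omega (grad (phi n) \- Df) by exact: L2vecB.
have qa := H1norm_inner_le n1; have qv := H1norm_inner_le vd.
have -> : (fun x => Df x - grad w x) = (fun x => grad v x + (-1) *: (grad (phi n) \- Df) x).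
  by apply/funext => x; rewrite gradB// scaleN1r /= !opprB addrA addrAC addrC addrA.
rewrite inner_quadratic//.
have := inner_ge0 Omega (fun x => grad v x + 1 *: (grad (phi n) \- Df) x).
rewrite inner_quadratic//; lra.
Qed.

End WeakDivergenceFree.

(** * The quadratic cost along a line *)

Section Observation.
Variables (R : realType) (Omega : set (point3 R)).
Hypothesis mO : measurable (Omega : set (borel3 R)).
Implicit Types (u : field R 3) (U V : field R 2).

Lemma L2vec_obs u : L2vec Omega u -> L2vec Omega (obs u).
Proof.
move=> Lu i; rewrite (_ : (fun _ => _) = fun x => u x (@lshift 2 1 i) 0); first exact: Lu.
by apply/funext => x; rewrite /obs mxE.
Qed.

Lemma L2vec_obs_adj U : L2vec Omega U -> L2vec Omega (obs_adj U).
Proof.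
move=> LU i; case: (@split_ordP 2 1 i) => j ->.
  rewrite (_ : (fun _ => _) = fun x => U x j 0); first exact: LU.
  by apply/funext => x; exact: (@col_mxEu R 2 1 1 (U x) 0 j 0).
rewrite (_ : (fun _ => _) = fun x => 0 * U x 0 0); first exact: L2Z.
by apply/funext => x; rewrite mul0r [LHS](@col_mxEd R 2 1 1 (U x) 0 j 0) mxE.
Qed.

Lemma L2vec_mulmx (S : 'M[R]_2) U : L2vec Omega U -> L2vec Omega (fun x => S *m U x).
Proof.
move=> LU i; rewrite (_ : (fun _ => _) = fun x => S i 0 * U x 0 0 + S i 1 * U x 1 0).
  by apply: L2D => //; exact: L2Z.
by apply/funext => x; rewrite mxE !big_ord_recl big_ord0 addr0; congr (_ + S i _ * U x _ 0);
  apply/val_inj.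
Qed.

Lemma inner_obs_adj U u : inner Omega (obs_adj U) u = inner Omega U (obs u).
Proof.
congr integral_on; apply/funext => x; rewrite /dot (@big_split_ord _ _ _ 2 1)/=.
rewrite big_ord1 [X in X * _](@col_mxEd R 2 1 1 (U x) 0 0 0) mxE mul0r addr0.
apply: eq_bigr => i _; congr (_ * _); first exact: (@col_mxEu R 2 1 1 (U x) 0 i 0).
by rewrite [RHS]mxE.
Qed.

Lemma obs_line u v (t : R) : obs (fun x => u x + t *: v x) = fun x => obs u x + t *: obs v x.
Proof. by apply/funext => x; apply/colP => i; rewrite !mxE. Qed.

Lemma inner_sym_mulmx (S : 'M[R]_2) U V : S^T = S ->
  inner Omega (fun x => S *m U x) V = inner Omega (fun x => S *m V x) U.
Proof.
move=> ST; have dotE (v w : 'cV[R]_2) : dot v w = (v^T *m w) 0 0.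
  by rewrite mxE; apply: eq_bigr => i _; rewrite mxE.
congr integral_on; apply/funext => x; rewrite !dotE !trmx_mul ST.
rewrite -[in LHS](trmxK ((U x)^T *m S *m V x)) [in LHS]mxE.
by rewrite !trmx_mul trmxK ST mulmxA.
Qed.

(** Expansion of the quadratic form; the two mixed terms are equal because S is
    symmetric. *)
Lemma J_line (S : 'M[R]_2) (U0 : field R 2) u v (t : R) : S^T = S ->
  L2vec Omega U0 -> L2vec Omega u -> L2vec Omega v ->
  J Omega S U0 (fun x => u x + t *: v x) =
  J Omega S U0 u + t * inner Omega (fun x => S *m (obs u x - U0 x)) (obs v)
  + t ^+ 2 / 2 * inner Omega (fun x => S *m obs v x) (obs v).
Proof.
move=> ST L0 Lu Lv.
have La : L2vec Omega (obs u \- U0) by apply: L2vecB => //; exact: L2vec_obs.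
have Lb := L2vec_obs Lv.
have Ltb : L2vec Omega (fun x => t *: obs v x) by exact: L2vecZ.
have LSa := L2vec_mulmx S La; have LSb := L2vec_mulmx S Lb.
have LtSb : L2vec Omega (fun x => t *: (S *m obs v x)) by exact: L2vecZ.
rewrite /J obs_line.
have -> : (fun x => S *m (obs u x + t *: obs v x - U0 x)) =
    fun x => (S *m (obs u \- U0) x) + t *: (S *m obs v x).
  by apply/funext => x; rewrite addrAC mulmxDr -scalemxAr.
have -> : (fun x => obs u x + t *: obs v x) \- U0 = fun x => (obs u \- U0) x + t *: obs v x.
  by apply/funext => x /=; rewrite addrAC.
have Lab := L2vecD mO La Ltb.
rewrite -[fun x => S *m (obs u x - U0 x)]/(fun x => S *m (obs u \- U0) x).
move: (obs u \- U0) La LSa Lab => a La LSa Lab.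
rewrite innerDl// innerZl// !innerDr// !innerZr//.
rewrite [inner Omega (fun x => S *m obs v x) a](inner_sym_mulmx _ _ ST).
by field.
Qed.

(** A nonnegative function with zero integral vanishes almost everywhere, and the
    integrand here vanishes only where U does. *)
Lemma inner_posdef_gt0 (S : 'M[R]_2) U : sym_posdef S -> L2vec Omega U ->
  ~ zero_ae Omega U -> 0 < inner Omega (fun x => S *m U x) U.
Proof.
move=> [_ Spos] LU nU.
have LSU := L2vec_mulmx S LU; have iSU := integ_dot mO LSU LU.
have Sge0 (v : 'cV[R]_2) : 0 <= dot (S *m v) v.
  have [->|v0] := eqVneq v 0; last exact/ltW/Spos.
  by apply: sumr_ge0 => i _; rewrite [X in _ * X]mxE mulr0.
rewrite lt_def; apply/andP; split; last by apply: Rintegral_ge0 => x _; exact: Sge0.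
apply/eqP => I0; apply: nU.
have mdot := integP iSU.
have : (\int[@lebesgue3 R]_(x in Omega) `|(dot (S *m U x) (U x))%:E| = 0)%E.
  transitivity (\int[@lebesgue3 R]_(x in Omega) (dot (S *m U x) (U x))%:E)%E.
    by apply: eq_integral => x _; rewrite gee0_abs// lee_fin.
  by rewrite -(fineK (integrable_fin_num mO iSU)); congr EFin.
move=> /(ae_eq_integral_abs _ mO (measurableT_comp (@EFin_measurable _ _) mdot)).
apply: filterS => x H Ox; have [//|U0] := eqVneq (U x) 0.
by have := H Ox => -[] E; have := Spos _ U0; rewrite E ltxx.
Qed.

End Observation.

Section Minimizer.
Variable R : realType.

(** Completing the square: f (t) = f (a / b) + (b / 2) (t - a / b)^2. *)
Lemma quadratic_unique_minimizer (f : R -> R) (c a b : R) : 0 < b ->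
  (forall t, f t = c - t * a + t ^+ 2 / 2 * b) -> unique_minimizer f (a / b).
Proof.
move=> b0 fE.
have sq t : f t = f (a / b) + b / 2 * (t - a / b) ^+ 2.
  by rewrite !fE; field; exact: lt0r_neq0.
split.
  by move=> s; rewrite [leRHS]sq lerDl mulr_ge0 ?sqr_ge0// divr_ge0// ltW.
move=> t' /(_ (a / b)); rewrite [leLHS]sq gerDl.
rewrite pmulr_rle0 ?divr_gt0// => H.
have : (t' - a / b) ^+ 2 == 0 by rewrite eq_le H sqr_ge0.
by rewrite expf_eq0/= subr_eq0 => /eqP.
Qed.

End Minimizer.

(** * The descent direction and the exact step *)

Theorem mainTheorem2 (R : realType) (Omega : set (point3 R))
    (S : 'M[R]_2) (U0 : field R 2) (uc : field R 3)
    (lambda : point3 R -> R) (Dlambda : field R 3) :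
  bounded_lipschitz_domain Omega ->
  sym_posdef S ->
  L2vec Omega U0 ->
  Ediv Omega uc ->
  H2 Omega lambda ->
  has_grad Omega lambda Dlambda ->
  let g : field R 3 := obs_adj (fun x => S *m (obs uc x - U0 x)) in
  (forall phi, test_function Omega phi ->
     distr_laplacian Omega lambda phi = distr_div Omega g phi) ->
  zero_normal_trace Omega (fun x => g x - Dlambda x) \/ zero_trace Omega lambda ->
  let p : field R 3 := fun x => - (g x - Dlambda x) in
  let f : R -> R := fun t => J Omega S U0 (fun x => uc x + t *: p x) in
  let SMp : field R 2 := fun x => S *m obs p x in
  (forall t : R,
     f t = J Omega S U0 uc - t * inner Omega p p
           + t ^+ 2 / 2 * inner Omega SMp (obs p)) /\
  (~ zero_ae Omega (obs p) ->
   let tc := inner Omega p p / inner Omega SMp (obs p) in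
   unique_minimizer f tc /\
   forall up : field R 3,
     adjusted_field (J Omega S U0) uc p up <->
     up = (fun x => uc x - tc *: (g x - Dlambda x))).
Proof.
move=> [oO _ _ bO _] Spd L0 [Luc _] _ hDl g gl bc p f SMp.
have mO : measurable (Omega : set (borel3 R)) := open_measurable3 oO.
have [ST Spos] := Spd; have [Ll LDl gradl] := hDl.
have Lg : L2vec Omega g.
  by apply: L2vec_obs_adj => //; apply: L2vec_mulmx => //; apply: L2vecB => //; exact: L2vec_obs.
pose h : field R 3 := fun x => g x - Dlambda x.
have Lh : L2vec Omega h by exact: L2vecB.
have Lp : L2vec Omega p by exact: L2vecN.
have h_test phi : test_function Omega phi -> inner Omega h (grad phi) = 0.
  exact: (weakly_divergence_free oO bO Lg hDl gl).
have Dl_h : inner Omega Dlambda h = 0.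
  (* Green's formula for a zero normal trace; density of truncations for a zero trace. *)
  case: bc => [[_ [d [Ld hd] /(_ lambda Dlambda hDl)]]|tr].
    rewrite /normal_trace (@integral_on_test_eq0 _ _ oO bO lambda d) ?add0r// => phi tphi.
    by rewrite -hd// /distr_div h_test// oppr0.
  have [Df hDf <-] := zero_trace_orthogonal oO bO Lh h_test tr.
  exact: inner_weak_gradient_unique hDl hDf.
have gp : inner Omega g p = - inner Omega p p.
  have -> : inner Omega g p = inner Omega (fun x => Dlambda x + (-1) *: p x) p.
    congr inner; apply/funext => x; rewrite scaleN1r /p opprK.
    by rewrite addrC subrK.
  rewrite innerDl//; last exact: L2vecZ.
  rewrite innerZl// mulN1r.
  rewrite (_ : inner Omega Dlambda p = 0) ?add0r//.
  have -> : p = fun x => (-1) *: h x by apply/funext => x; rewrite scaleN1r.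
  by rewrite innerZr// Dl_h mulr0.
have fE t : f t = J Omega S U0 uc - t * inner Omega p p
           + t ^+ 2 / 2 * inner Omega SMp (obs p).
  by rewrite /f J_line// -inner_obs_adj gp mulrN.
split => // np tc.
have min_tc : unique_minimizer f tc.
  apply: quadratic_unique_minimizer fE.
  by apply: inner_posdef_gt0 => //; exact: L2vec_obs.
have pE t : (fun x => uc x + t *: p x) = fun x => uc x - t *: (g x - Dlambda x).
  by apply/funext => x; rewrite /p scalerN.
split => // up; split.
  move=> [t mint ->]; rewrite pE.
  by have -> : t = tc by apply: (min_tc.2); case: mint.
by move=> ->; exists tc => //; rewrite pE.
Qed.
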